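(* Let $F$ be an oriented surface, $L$ a generic oriented cooriented wave front on $F$, and $\lambda\subset ST^*F$ the corresponding Legendrian curve. Let $$S(\lambda)=\sum_v\Bigl([\tilde\lambda^+_v]-[\tilde\lambda^-_v]\Bigr)+(f-[\lambda])C^+ +([\lambda]f-e)C^-\in\tfrac12\mathbb{Z}[H_1(ST^*F)]$$ and $$l_F(\lambda)=\Bigl(\prod_v[\lambda^+_v][\lambda^-_v]^{-1}f^{-\epsilon(v)}\Bigr)(f[\lambda]^{-1})^{C^+}([\lambda]f)^{C^-}\in H_1(ST^*F,\tfrac12\mathbb{Z}),$$ where $v$ runs over all double points of $L$. Let $$\mathrm{pr}:\tfrac12\mathbb{Z}[H_1(ST^*F)]\to H_1(ST^*F,\tfrac12\mathbb{Z}),\qquad \sum n_ig_i\mapsto\prod g_i^{n_i}\quad (n_i\in\tfrac12\mathbb{Z},\ g_i\in H_1(ST^*F)).$$ Then $\mathrm{pr}(S(\lambda))=l_F(\lambda)$.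
   Context: $ST^*F$ is the space of cooriented contact elements of $F$, an $S^1$-fibration over $F$ with its natural contact structure; a Legendrian curve is an immersed circle tangent to the contact planes, its cooriented projection is its wave front, from which it is recovered by taking the coorienting normal directions. A front is generic if it is an immersion except at finitely many cusps, and all multiple points are transversal double points. $\frac12\mathbb{Z}[G]$ is the group of formal half-integer linear combinations of elements of $G$. The operation in homology is written multiplicatively (also in $H_1(ST^*F,\frac12\mathbb{Z})$, where half-integer powers make sense); $e$ is the zero class. Fibers are oriented by positive rotation with respect to the orientation of $F$; $f$ is the class of a positively oriented fiber. A branch of $L$ is positive (negative) if the frame (coorienting vector, orienting vector) is positively (negatively) oriented. For a double point $v$, $\epsilon(v)=+1$ if the signs of the two branches at $v$ coincide and $-1$ otherwise. A cusp is positive (negative) if the coorienting vector turns in the positive (negative) direction while traversing a neighborhood of the cusp along the orientation; $C^+$, $C^-$ are half the numbers of positive and negative cusps. At a double point $v$ the fiber over $v$ divides $\lambda$ into two oriented arcs. Identify (preserving orientation) a neighborhood of $v$ in $F$ with a plane in which both branches of $L$ are directed upwards; the projections of the two arcs give the two pieces (left and right at $v$) of the oriented smoothing of $L$ at $v$. (1) $[\tilde\lambda^+_v]$ (respectively $[\tilde\lambda^-_v]$) is the homology class of the closed curve obtained from the left (respectively right) arc of $\lambda$ by adding the arc of the fiber which, with the positive fiber orientation, runs from the end point of the arc of $\lambda$ to its starting point. (2) $\lambda^{\pm}_v$ are the Legendrian liftings of the two fronts $L^+_v$ (left at $v$) and $L^-_v$ (right at $v$) obtained by splitting $L$ at $v$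 with respect to orientation and coorientation; the class $[\lambda^+_v]$ (respectively $[\lambda^-_v]$) is that of the closed curve obtained from the left (respectively right) arc of $\lambda$ by joining its end point to its starting point along the shorter of the two arcs of the fiber circle (the arc of coorienting directions of angle less than $\pi$, traversed in whichever direction is needed). *)

(* Defs.v *)
From HB Require Import structures.
From mathcomp Require Import all_boot all_order all_algebra.
From mathcomp Require Import generic_quotient ring_quotient.
From mathcomp Require Import all_classical all_reals all_analysis.
From mathcomp Require Import finmap ring.
From mathcomp Require Import (canonicals) monalg.

Set Implicit Arguments.
Unset Strict Implicit.
Unset Printing Implicit Defensive.

Import Order.TTheory GRing.Theory Num.Theory.
Import numFieldNormedType.Exports.

Local Open Scope classical_set_scope.
Local Open Scope ring_scope.

Lemma continuous_mx_at (K : numFieldType) (T : topologicalType) m n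
    (f : T -> 'M[K]_(m, n)) (t : T) :
  (forall i j, {for t, continuous (fun s => f s i j)}) -> {for t, continuous f}.
Proof.
move=> fc A [P fP sPA]; rewrite nbhs_simpl /=.
suff : \forall s \near t, forall i j, P i j (f s i j).
  by apply: filterS => s Ps; apply: sPA.
by apply: filter_forall => i; apply: filter_forall => j; apply: fc; apply: fP.
Qed.

(* The group 1/2 Z, as a subgroup of the rationals; [half k] is k/2. *)
Definition is_halfint : {pred rat} := [pred x | x *+ 2 \is a Num.int].

Lemma is_halfint_zmod_closed : zmod_closed is_halfint.
Proof.
by split=> [|x y]; rewrite !inE ?mul0rn ?rpred0 // => hx hy; rewrite mulrnBl rpredB.
Qed.

HB.instance Definition _ :=
  GRing.isZmodClosed.Build rat is_halfint is_halfint_zmod_closed.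

Record halfint := HalfInt { rat_of_halfint : rat; _ : rat_of_halfint \in is_halfint }.
HB.instance Definition _ := [isSub for rat_of_halfint].
HB.instance Definition _ := [Choice of halfint by <:].
HB.instance Definition _ := [SubChoice_isSubZmodule of halfint by <:].

Lemma half_subproof (k : int) : (k%:~R / 2 : rat) \in is_halfint.
Proof.
rewrite inE.
suff -> : (k%:~R / 2 : rat) *+ 2 = k%:~R by exact: intr_int.
by rewrite -[LHS]mulr_natr divfK ?pnatr_eq0.
Qed.

Definition half (k : int) : halfint := HalfInt (half_subproof k).

Definition half_unit : halfint := half 2.

(* [monalg.malg K G] is the group of finitely supported functions K -> G, i.e.
   of formal G-linear combinations of elements of K; [monalg.mkmalgU k z] is
   the formal combination z k. *)

Definition extend_by_sum (K : choiceType) (G M : zmodType) (f : K -> G -> M)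
    (c : monalg.malg K G) : M :=
  \sum_(k <- monalg.msupp c) f k (monalg.mcoeff k c).

Lemma extend_by_sumB (K : choiceType) (G M : zmodType) (f : K -> G -> M) :
  (forall k, {morph f k : x y / x - y}) ->
  {morph extend_by_sum f : c d / c - d}.
Proof.
move=> fB c d; have f0 k : f k 0 = 0 by rewrite -[0 in LHS](subrr 0) fB subrr.
pose D := (monalg.msupp c `|` monalg.msupp d)%fset.
have widen e : (monalg.msupp e `<=` D)%fset ->
    extend_by_sum f e = \sum_(k <- D) f k (monalg.mcoeff k e).
  move=> eD; apply: big_fset_incl => // k _ /monalg.mcoeff_outdom ->.
  exact: f0.
rewrite !widen ?fsubsetUl ?fsubsetUr ?monalg.msuppB_le // -sumrB.
by apply: eq_bigr => k _; rewrite monalg.mcoeffB fB.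
Qed.

Section SingularHomology.
Variable R : realType.

Definition std_simplex (n : nat) : set 'rV[R]_n.+1 :=
  [set x | (forall i, 0 <= x 0 i) /\ \sum_i x 0 i = 1].
Arguments std_simplex : clear implicits.

Definition face_row n (i : 'I_n.+2) (x : 'rV[R]_n.+1) : 'rV[R]_n.+2 :=
  \row_j if unlift i j is Some k then x 0 k else 0.

Lemma face_subproof n (i : 'I_n.+2) (x : std_simplex n) :
  face_row i (set_val x) \in std_simplex n.+1.
Proof.
have [x0 x1] := set_valP x; apply/mem_set; split.
  by move=> j; rewrite mxE; case: unlift => [k|].
rewrite (bigD1_ord i) //= mxE unlift_none add0r -[RHS]x1.
by apply: eq_bigr => j _; rewrite mxE liftK.
Qed.

Definition face n (i : 'I_n.+2) (x : std_simplex n) : std_simplex n.+1 :=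
  exist _ (face_row i (set_val x)) (face_subproof i x).

Lemma face_continuous n (i : 'I_n.+2) : continuous (@face n i).
Proof.
apply: (@continuous_comp_initial _ _ _ set_val) => x.
apply: continuous_mx_at => k j.
rewrite (_ : (fun s => _) = (fun s : std_simplex n =>
   if unlift i j is Some l then (set_val s : 'rV[R]_n.+1) 0 l else 0)); last first.
  by apply/funext => s; rewrite set_valE /= mxE.
case: (unlift i j) => [l|]; last exact: cst_continuous.
apply: (@continuous_comp _ _ _ set_val (fun s : 'rV[R]_n.+1 => s 0 l)).
  exact: initial_continuous.
exact: coord_continuous.
Qed.

HB.instance Definition _ n (i : 'I_n.+2) :=
  isContinuous.Build _ _ (@face n i) (@face_continuous n i).

Definition singular (n : nat) (X : topologicalType) : Type :=
  continuousType (std_simplex n) X.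
HB.instance Definition _ n X := Choice.on (singular n X).

Definition chain (n : nat) (X : topologicalType) (G : zmodType) : Type :=
  monalg.malg (singular n X) G.
HB.instance Definition _ n X G := GRing.Zmodule.on (chain n X G).

Definition boundary n X G : chain n.+1 X G -> chain n X G :=
  extend_by_sum (fun (s : singular n.+1 X) (z : G) => \sum_(i < n.+2)
    monalg.mkmalgU (s \o @face n i : singular n X) (z *~ ((-1) ^+ i))).

Lemma boundaryB n X G : {morph @boundary n X G : c d / c - d}.
Proof.
apply: extend_by_sumB => s x y; rewrite -sumrB.
by apply: eq_bigr => i _; rewrite mulrzBl raddfB.
Qed.

Section H1.
Variables (X : topologicalType) (G : zmodType).

Definition is_cycle : {pred chain 1 X G} := [pred c | boundary c == 0].

Lemma is_cycle_zmod_closed : zmod_closed is_cycle.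
Proof.
have boundary0 : boundary (0 : chain 1 X G) = 0.
  by rewrite -[0 in LHS](subrr 0) boundaryB subrr.
split=> [|c d]; first exact/eqP.
by move=> /eqP c0 /eqP d0; apply/eqP; rewrite boundaryB c0 d0 subrr.
Qed.
HB.instance Definition _ :=
  GRing.isZmodClosed.Build (chain 1 X G) is_cycle is_cycle_zmod_closed.

Record cycle1 := Cycle1 { chain_of_cycle : chain 1 X G; _ : chain_of_cycle \in is_cycle }.
HB.instance Definition _ := [isSub for chain_of_cycle].
HB.instance Definition _ := [Choice of cycle1 by <:].
HB.instance Definition _ := [SubChoice_isSubZmodule of cycle1 by <:].

Definition is_boundary : {pred cycle1} :=
  [pred z | `[< exists c : chain 2 X G, boundary c = chain_of_cycle z >]].

Lemma is_boundary_zmod_closed : zmod_closed is_boundary.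
Proof.
split=> [|y z]; rewrite !unfold_in.
  by apply/asboolP; exists (0 - 0); rewrite boundaryB subrr.
move=> /asboolP[c cy] /asboolP[d dz]; apply/asboolP; exists (c - d).
by rewrite boundaryB cy dz -(raddfB (val : cycle1 -> chain 1 X G)).
Qed.
HB.instance Definition _ :=
  GRing.isZmodClosed.Build cycle1 is_boundary is_boundary_zmod_closed.

Definition H1 : Type := Quotient.quot is_boundary.
HB.instance Definition _ := GRing.Zmodule.on H1.

HB.instance Definition _ := EqQuotient.on H1.

(* The homology class of a 1-chain; the value 0 on chains that are not cycles
   is a mere default. *)
Definition hclass (c : chain 1 X G) : H1 := \pi_(H1)%qT (insubd (0 : cycle1) c).

End H1.

(* The map H_1(X; G) -> H_1(X; G') induced by an additive phi : G -> G'. *)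
Definition coef_map (X : topologicalType) (G G' : zmodType) (phi : G -> G')
    (h : H1 X G) : H1 X G' :=
  hclass (extend_by_sum (fun (s : singular 1 X) (z : G) => monalg.mkmalgU s (phi z))
            (chain_of_cycle (repr h))).

(* [edge g a b] is the singular 1-simplex t |-> g (a + (b - a) t). *)
Definition edge_param (a b : R) (x : std_simplex 1) : R :=
  a + (b - a) * (set_val x : 'rV[R]_2) 0 1.

Lemma edge_param_continuous a b : continuous (edge_param a b).
Proof.
pose f (x : std_simplex 1) : R := (set_val x : 'rV[R]_2) 0 1.
pose g (t : R) : R := a + (b - a) * t.
have fc : continuous f.
  move=> x; apply: (@continuous_comp _ _ _ set_val (fun s : 'rV[R]_2 => s 0 1)).
    exact: initial_continuous.
  exact: coord_continuous.
have gc : continuous g.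
  by move=> x; apply: cvgD; [exact: cvg_cst|apply: cvgM; [exact: cvg_cst|exact: cvg_id]].
by move=> x; exact: (@continuous_comp _ _ _ f g x (fc x) (gc _)).
Qed.
HB.instance Definition _ a b :=
  isContinuous.Build _ _ (edge_param a b) (@edge_param_continuous a b).

Definition edge (X : topologicalType) (g : continuousType R X) (a b : R) :
    chain 1 X int :=
  monalg.mkmalgU (g \o edge_param a b : singular 1 X) 1.

End SingularHomology.

(* g ^ n for g in H_1(X; Z) and n in 1/2 Z, an element of H_1(X; 1/2 Z). *)
Definition hpow (R : realType) (X : topologicalType) (g : H1 R X int) (n : halfint) :
    H1 R X halfint :=
  coef_map (fun k : int => n *~ k) g.

(* 1/2 Z [A], the formal half-integer linear combinations of elements of A. *)
Definition half_comb (A : choiceType) : zmodType := monalg.malg A halfint.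

Definition formal (A : choiceType) (n : halfint) (g : A) : half_comb A :=
  monalg.mkmalgU g n.

Definition pr (R : realType) (X : topologicalType) :
    half_comb (H1 R X int) -> H1 R X halfint :=
  extend_by_sum (fun g n => hpow g n).

Section Surface.
Variable R : realType.

Notation plane := 'rV[R]_2.

Definition dot (u w : plane) : R := u 0 0 * w 0 0 + u 0 1 * w 0 1.
Definition det2 (u w : plane) : R := u 0 0 * w 0 1 - u 0 1 * w 0 0.
Definition eucl (u : plane) : R := Num.sqrt (dot u u).
Definition normalize (u : plane) : plane := (eucl u)^-1 *: u.
Definition rotate (t : R) (u : plane) : plane :=
  \row_j if j == 0 then cos t * u 0 0 - sin t * u 0 1
                   else sin t * u 0 0 + cos t * u 0 1.

Lemma eucl_rotate t u : eucl (rotate t u) = eucl u.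
Proof.
rewrite /eucl /dot !mxE /=; congr (Num.sqrt _).
transitivity ((cos t ^+ 2 + sin t ^+ 2) * (u 0 0 * u 0 0 + u 0 1 * u 0 1)).
  by ring.
by rewrite cos2Dsin2 mul1r.
Qed.

Lemma eucl_eq0 u : eucl u = 0 -> u = 0.
Proof.
move/eqP; rewrite sqrtr_eq0 /dot -!expr2 => le0.
have /andP[/eqP u0 /eqP u1] : (u 0 0 ^+ 2 == 0) && (u 0 1 ^+ 2 == 0).
  by rewrite -paddr_eq0 ?sqr_ge0 // eq_le le0 addr_ge0 ?sqr_ge0.
apply/rowP => j; rewrite mxE; apply/eqP; rewrite -sqrf_eq0; apply/eqP.
by case: j => -[|[|//]] lt_j; [rewrite -u0|rewrite -u1];
  congr (u 0 _ ^+ 2); apply: val_inj.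
Qed.

Lemma rotate_continuous u : continuous (rotate^~ u).
Proof.
move=> t; apply: continuous_mx_at => i j.
have c_cst (f : R -> R) (a : R) : continuous f -> continuous (fun s => f s * a).
  by move=> fc s; apply: cvgM; [exact: fc|exact: cvg_cst].
have [c s] := (@continuous_cos R, @continuous_sin R).
rewrite (_ : (fun s => _) = (fun s => if j == 0 then cos s * u 0 0 - sin s * u 0 1
    else sin s * u 0 0 + cos s * u 0 1)); last by apply/funext => ?; rewrite mxE.
by case: (j == 0); [apply: cvgB|apply: cvgD]; apply: c_cst.
Qed.

Lemma normalize_continuous u : u != 0 -> {for u, continuous normalize}.
Proof.
move=> u0; have c i : continuous (fun v : plane => v 0 i) by exact: coord_continuous.
have eucl_c : {for u, continuous eucl}.
  apply: (@continuous_comp _ _ _ (fun v => dot v v) Num.sqrt).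
    exact: (cvgD (cvgM (c 0 u) (c 0 u)) (cvgM (c 1 u) (c 1 u))).
  exact: sqrt_continuous.
have e0 : eucl u != 0 by apply: contra_neq u0; exact: eucl_eq0.
exact: (cvgZ (cvgV e0 eucl_c) (@cvg_id _ (nbhs u))).
Qed.

Lemma mulmx_continuous (M : 'M[R]_2) : continuous (fun u : plane => u *m M).
Proof.
move=> u; apply: continuous_mx_at => i j.
rewrite (_ : (fun s => _) = (fun s : plane => s i 0 * M 0 j + s i 1 * M 1 j)); last first.
  apply/funext => s; rewrite !mxE big_ord_recl big_ord1.
  by congr (_ + s i _ * M _ j); apply: val_inj.
have c k : (fun s : plane => s i k) @ u --> u i k by exact: coord_continuous.
exact: (cvgD (cvgM (c 0) (cvg_cst _)) (cvgM (c 1) (cvg_cst _))).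
Qed.

(* On an open set A this is being of class C^oo: every iterated directional
   derivative is differentiable. *)
Definition smooth_on (A : set plane) (f : plane -> plane) : Prop :=
  forall (vs : seq plane) (x : plane), A x ->
    differentiable (foldr (fun v g => fun y => 'D_v g y) f vs) x.

Record chart (F : topologicalType) := Chart {
  dom : set F;
  coords : F -> plane;
  param : plane -> F;
  dom_open : open dom;
  range_open : open (coords @` dom);
  coordsK : forall p, dom p -> param (coords p) = p;
  coords_continuous : forall p, dom p -> {for p, continuous coords};
  param_continuous : forall x, (coords @` dom) x -> {for x, continuous param}
}.

(* A connected oriented smooth surface, given by an atlas with smooth,
   orientation-preserving changes of coordinates. The atlas is indexed by the
   points so that a chart around each point is singled out. *)
Record surface := Surface {
  carrier :> topologicalType;
  surface_hausdorff : hausdorff_space carrier;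
  surface_second_countable : @second_countable carrier;
  surface_connected : connected [set: carrier];
  chart_at : carrier -> chart carrier;
  mem_chart_at : forall p, dom (chart_at p) p;
  chart_compat : forall p q : carrier,
    let A := coords (chart_at p) @` (dom (chart_at p) `&` dom (chart_at q)) in
    let change := coords (chart_at q) \o param (chart_at p) in
    smooth_on A change /\ forall x, A x -> 0 < \det ('J change x)
}.

Section ContactElements.
Variable F : surface.

(* A cooriented contact element at p is a nonzero covector at p up to positive
   scaling (its kernel is the contact line, the side where it is positive the
   coorientation). It is recorded by the components, of euclidean norm 1, of
   this covector in the chart singled out at p. *)
Record STF := ContactElement {
  base : F;
  codir : plane;
  codir_unit : eucl codir = 1
}.
HB.instance Definition _ := gen_eqMixin STF.
HB.instance Definition _ := gen_choiceMixin STF.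

(* The components, of norm 1, in the chart at q; 'J is the matrix of the
   differential acting on row vectors, so covectors transform by its transpose. *)
Definition comps (q : F) (xi : STF) : plane :=
  normalize (codir xi *m
    ('J (coords (chart_at (base xi)) \o param (chart_at q))
        (coords (chart_at q) (base xi)))^T).

(* A set is open if its traces in the trivializations are open. *)
Definition STF_open (A : set STF) : Prop :=
  forall (q : F) (xi : STF), dom (chart_at q) (base xi) -> A xi ->
    exists (U : set F) (W : set plane),
      [/\ nbhs (base xi) U, nbhs (comps q xi) W &
          forall eta : STF, U (base eta) -> W (comps q eta) -> A eta].

Lemma STF_openT : STF_open setT.
Proof. by move=> q xi _ _; exists setT, setT; split=> //; exact: filterT. Qed.

Lemma STF_openI (A B : set STF) : STF_open A -> STF_open B -> STF_open (A `&` B).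
Proof.
move=> oA oB q xi dxi [Axi Bxi].
have [U [W [nO nW sA]]] := oA q xi dxi Axi.
have [U' [W' [nO' nW' sB]]] := oB q xi dxi Bxi.
exists (U `&` U'), (W `&` W'); split; [exact: filterI|exact: filterI|].
by move=> eta [? ?] [? ?]; split; [exact: sA|exact: sB].
Qed.

Lemma STF_open_bigU (I : Type) (f : I -> set STF) :
  (forall i, STF_open (f i)) -> STF_open (\bigcup_i f i).
Proof.
move=> of_ q xi dxi [i _ fxi]; have [U [W [nO nW sf]]] := of_ i q xi dxi fxi.
by exists U, W; split=> // eta Oe We; exists i => //; exact: sf.
Qed.

HB.instance Definition _ :=
  isOpenTopological.Build STF STF_openT STF_openI STF_open_bigU.

(* The positive rotation by the angle t in the fiber, as seen in the chart
   singled out at the base point. *)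
Definition turn (xi : STF) (t : R) : STF :=
  ContactElement (base xi) (etrans (eucl_rotate t (codir xi)) (codir_unit xi)).

Lemma turn_continuous xi : continuous (turn xi).
Proof.
apply/continuousP => A oA; rewrite openE => t At; rewrite /interior /=.
have [U [W [nU nW sA]]] := oA (base xi) (turn xi t) (mem_chart_at _) At.
set p := base xi in sA nU nW.
set M := ('J (coords (chart_at p) \o param (chart_at p)) (coords (chart_at p) p))^T.
have M_unit : M \in unitmx.
  rewrite unitmxE det_tr unitfE lt0r_neq0 //.
  have [_] := chart_compat p p; apply; exists p => //.
  by split; exact: mem_chart_at.
have compsE s : comps p (turn xi s) = normalize (rotate s (codir xi) *m M) by [].
have c : {for t, continuous (fun s => comps p (turn xi s))}.
  apply: (@continuous_comp _ _ _ (fun s => rotate s (codir xi) *m M) normalize).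
    apply: (@continuous_comp _ _ _ (rotate^~ (codir xi)) (mulmx^~ M)).
      exact: rotate_continuous.
    exact: mulmx_continuous.
  apply: normalize_continuous; apply/eqP => /(congr1 (mulmx^~ (invmx M))).
  rewrite mul0mx mulmxK // => rot0.
  have := codir_unit (turn xi t); rewrite /= rot0 /eucl /dot !mxE mul0r addr0 sqrtr0.
  by move/esym/eqP; rewrite oner_eq0.
have sub : (fun s => comps p (turn xi s)) @^-1` W `<=` turn xi @^-1` A.
  by move=> s Ws; apply: sA => //; exact: (nbhs_singleton nU).
exact: (@filterS _ (nbhs t) (nbhs_filter t) _ _ sub (c _ nW)).
Qed.

HB.instance Definition _ xi := isContinuous.Build _ _ (turn xi) (@turn_continuous xi).

(* The fiber through xi, positively oriented, as a loop based at xi. *)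
Definition fiber_class (xi : STF) : H1 R STF int :=
  hclass (edge (turn xi) 0 (pi *+ 2)).

(* For distinct, non-opposite xi and eta in the same fiber: the arc running from xi to eta in the
   positive direction, and the arc of angle less than pi from xi to eta. *)
Definition positive_arc (xi eta : STF) : chain R 1 STF int :=
  edge (turn xi) 0 (xget 0 [set t | 0 <= t < pi *+ 2 /\ turn xi t = eta]).
Definition short_arc (xi eta : STF) : chain R 1 STF int :=
  edge (turn xi) 0 (xget 0 [set t | - pi < t < pi /\ turn xi t = eta]).

(* The front of a curve in ST^*F, and its coorientation, read in the chart at q. *)
Definition front_in (q : F) (c : R -> STF) (t : R) : plane :=
  coords (chart_at q) (base (c t)).
Definition coor_in (q : F) (c : R -> STF) (t : R) : plane := comps q (c t).

(* An oriented Legendrian curve, as a map from the circle R / Z. *)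
Record legendrian := Legendrian {
  legendrian_map :> R -> STF;
  legendrian_continuous : continuous legendrian_map;
  legendrian_periodic : forall t, legendrian_map (t + 1) = legendrian_map t;
  legendrian_smooth : forall (q : F) (t : R) (n : nat),
    dom (chart_at q) (base (legendrian_map t)) ->
    derivable (derive1n n (front_in q legendrian_map)) t 1 /\
    derivable (derive1n n (coor_in q legendrian_map)) t 1;
  legendrian_immersed : forall (q : F) (t : R),
    dom (chart_at q) (base (legendrian_map t)) ->
    derive1 (front_in q legendrian_map) t != 0 \/
    derive1 (coor_in q legendrian_map) t != 0;
  legendrian_tangent : forall (q : F) (t : R),
    dom (chart_at q) (base (legendrian_map t)) ->
    dot (coor_in q legendrian_map t) (derive1 (front_in q legendrian_map) t) = 0
}.

HB.instance Definition _ (lam : legendrian) :=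
  isContinuous.Build _ _ (legendrian_map lam) (@legendrian_continuous lam).

Section Curve.
Variable lam : legendrian.

(* The n-th derivative of the front at t, in the chart singled out at the point
   of the front with parameter t. *)
Definition front_derivative (n : nat) (t : R) : plane :=
  derive1n n (front_in (base (lam t)) lam) t.
Definition velocity (t : R) : plane := front_derivative 1 t.

(* A set of representatives of R / Z. *)
Definition period : set R := [set t | 0 <= t < 1].

Definition singular_parameters : set R := [set t | period t /\ velocity t = 0].

(* The standard (semicubical) cusp: the second and third derivatives of the
   front are independent; this does not depend on the chart. *)
Definition is_cusp (t : R) : Prop :=
  velocity t = 0 /\ det2 (front_derivative 2 t) (front_derivative 3 t) != 0.

Record generic_front : Prop := GenericFront {
  finitely_many_singular : finite_set singular_parameters;
  singular_is_cusp : forall t, singular_parameters t -> is_cusp t;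
  no_triple_point : forall a b c, period a -> period b -> period c ->
    base (lam a) = base (lam b) -> base (lam b) = base (lam c) ->
    [\/ a = b, b = c | a = c];
  double_point_transversal : forall a b, period a -> period b -> a <> b ->
    base (lam a) = base (lam b) -> det2 (velocity a) (velocity b) != 0
}.

(* The dual of the euclidean structure of the chart turns codir into a
   coorienting vector, so this compares the frame (coorienting vector,
   orienting vector) with the orientation. *)
Definition positive_branch (t : R) : bool := 0 < det2 (codir (lam t)) (velocity t).

(* At a singular point the angular velocity of the coorientation does not vanish,
   by immersivity, and its sign is the direction in which the coorienting vector
   turns. *)
Definition positive_cusps : set R := [set t | singular_parameters t /\
  0 < det2 (codir (lam t)) (derive1 (coor_in (base (lam t)) lam) t)].
Definition negative_cusps : set R := [set t | singular_parameters t /\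
  det2 (codir (lam t)) (derive1 (coor_in (base (lam t)) lam) t) < 0].

(* Half the numbers of positive and of negative cusps. *)
Definition Cplus : halfint := half #|` fset_set positive_cusps|%fset%:Z.
Definition Cminus : halfint := half #|` fset_set negative_cusps|%fset%:Z.

Definition double_points : set F := [set v | exists a b,
  [/\ period a, period b, a <> b, base (lam a) = v & base (lam b) = v]].

(* The piece of the smoothing that arrives along a branch of velocity w_in and
   leaves along a branch of velocity w_out lies on the left: in some
   orientation-preserving identification with the plane in which both branches
   are directed upwards, it comes from below and heads to the upper right, then
   leaves to the upper left. *)
Definition turns_left (w_in w_out : plane) : Prop :=
  exists P : 'M[R]_2, [/\ 0 < \det P,
    0 < (w_in *m P) 0 1, 0 < (w_out *m P) 0 1,
    0 < (w_in *m P) 0 0 & (w_out *m P) 0 0 < 0].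

(* The parameters (a, b) of the two branches at v for which the left arc of lam
   starts at a and ends at b; the right arc then runs from b to a. *)
Definition branches (v : F) : R * R := xget (0, 0) [set ab |
  [/\ period ab.1, period ab.2, base (lam ab.1) = v, base (lam ab.2) = v &
      turns_left (velocity ab.2) (velocity ab.1)]].

Definition arc (a b : R) : chain R 1 STF int :=
  edge lam a (if a < b then b else b + 1).

(* The class of a closed curve made of two successive pieces is that of the sum
   of the pieces. *)
Definition lambda_tilde_plus (v : F) : H1 R STF int :=
  let: (a, b) := branches v in hclass (arc a b + positive_arc (lam b) (lam a)).
Definition lambda_tilde_minus (v : F) : H1 R STF int :=
  let: (a, b) := branches v in hclass (arc b a + positive_arc (lam a) (lam b)).
Definition lambda_plus (v : F) : H1 R STF int :=
  let: (a, b) := branches v in hclass (arc a b + short_arc (lam b) (lam a)).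
Definition lambda_minus (v : F) : H1 R STF int :=
  let: (a, b) := branches v in hclass (arc b a + short_arc (lam a) (lam b)).

Definition curve_class : H1 R STF int := hclass (edge lam 0 1).

Definition epsilon (v : F) : int :=
  let: (a, b) := branches v in
  if positive_branch a == positive_branch b then 1 else -1.

(* The group law of homology is written additively; f is the class of the
   fiber, and the class e is 0. *)
Definition S_invariant (f : H1 R STF int) : half_comb (H1 R STF int) :=
  \sum_(v \in double_points)
     (formal half_unit (lambda_tilde_plus v) - formal half_unit (lambda_tilde_minus v))
  + (formal Cplus f - formal Cplus curve_class)
  + (formal Cminus (curve_class + f) - formal Cminus 0).

Definition l_invariant (f : H1 R STF int) : H1 R STF halfint :=
  \sum_(v \in double_points)
     hpow (lambda_plus v - lambda_minus v - f *~ epsilon v) half_unit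
  + hpow (f - curve_class) Cplus
  + hpow (curve_class + f) Cminus.

End Curve.
End ContactElements.
End Surface.

(* Main.v *)
From HB Require Import structures.
Require Import Defs.
From mathcomp Require Import all_boot all_order all_algebra.
From mathcomp Require Import generic_quotient ring_quotient.
From mathcomp Require Import all_classical all_reals all_analysis.
From mathcomp Require Import finmap ring lra zify.
From mathcomp Require Import (canonicals) monalg.

Set Implicit Arguments.
Unset Strict Implicit.
Unset Printing Implicit Defensive.

Import Order.TTheory GRing.Theory Num.Theory.
Import numFieldNormedType.Exports.

Local Open Scope classical_set_scope.
Local Open Scope ring_scope.

(** The projection pr is additive, and so is [hpow] in each argument; hence
    pr sends a difference n.g - n.h of formal terms to the n-th power of g - h,
    and the cusp terms of S and of l correspond at once: the class f - [lambda]
    carries the exponent of the positive cusps, [lambda] + f that of the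
    negative ones, and the powers of the zero class vanish.

    There remains, at each double point v, an identity between integral
    classes: [tilde lambda^+] - [tilde lambda^-] = [lambda^+] - [lambda^-] -
    epsilon f. Both sides are built from the same two arcs of lambda, which are
    closed up by positive arcs of the fiber over v in the loops with a tilde
    and by shortest arcs in the loops without. If x_a and x_b are the two
    contact elements of lambda over v, write x_a as x_b turned by an angle t
    between -pi and pi. For t > 0 the positive and the shortest arc from x_b to
    x_a coincide, while those from x_a to x_b differ by a full turn; for t < 0
    the roles are exchanged ([positive_short_arc]). So the two sides agree up
    to f, with the sign of t, that is of the determinant of the coorienting
    covectors. These covectors annihilate the velocities, so this determinant
    times the two branch signs is the determinant of the velocities up to a
    positive factor ([det2_velocity]), and the latter is positive because the
    first arc is the one on the left: the sign of t is epsilon(v).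

    Two facts make this argument complete. First, a full turn must give the same
    class f in every fiber ([fiber_class_const]). The surface being connected, it
    is enough to compare fibers over one coordinate ball. There a fiber is seen
    as a circle turned by a linear map of positive determinant, which is deformed
    into a similarity by shrinking its anticonformal part; two circles turned by
    similarities are then joined by moving the base point and the phase.

    Secondly, a sum over infinitely many double points would be meaningless: the
    double points must be finite in number ([finite_double_points]). By
    compactness it is enough that every pair of parameters is isolated among the
    pairs of distinct parameters with the same image. Away from the diagonal this
    is transversality; on the diagonal the front is locally injective, at a regular
    point because some coordinate has nonzero derivative and at a cusp because
    some linear coordinate behaves like a cubic. *)

(** * Chains, homology classes and half-integer powers *)

Lemma extend_by_sumU (K : choiceType) (G M : zmodType) (f : K -> G -> M) k x :
  f k 0 = 0 -> extend_by_sum f (monalg.mkmalgU k x) = f k x.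
Proof.
move=> f0; rewrite /extend_by_sum monalg.msuppU.
case: eqVneq => [->|x0]; first by rewrite big_seq_fset0 f0.
by rewrite big_seq_fset1 monalg.mcoeffUU.
Qed.

HB.instance Definition _ (R : realType) n (X : topologicalType) (G : zmodType) :=
  GRing.isZmodMorphism.Build _ _ (@boundary R n X G) (@boundaryB R n X G).

Section Homology.
Variables (R : realType) (X : topologicalType).
Implicit Types G : zmodType.

Definition simplex G n (s : singular R n X) (x : G) : chain R n X G :=
  monalg.mkmalgU s x.

Lemma simplexB G n (s : singular R n X) : {morph @simplex G n s : x y / x - y}.
Proof. exact: monalg.monalgUB. Qed.

HB.instance Definition _ G n (s : singular R n X) :=
  GRing.isZmodMorphism.Build G (chain R n X G) (simplex s) (simplexB s).

Lemma chain_morph_eq G (M : zmodType) n (f g : {additive chain R n X G -> M}) :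
  (forall s x, f (simplex s x) = g (simplex s x)) -> f =1 g.
Proof.
move=> fg c.
have -> : c = \sum_(s <- monalg.msupp c) simplex s (monalg.mcoeff s c).
  exact: monalg.monalgE.
by rewrite !raddf_sum; apply: eq_bigr => s _; exact: fg.
Qed.

Lemma boundary_simplex G n (s : singular R n.+1 X) (x : G) :
  boundary (simplex s x) =
  \sum_(i < n.+2) simplex (s \o @face R n i : singular R n X) (x *~ ((-1) ^+ i)).
Proof.
rewrite /boundary extend_by_sumU //.
by apply: big1 => i _; rewrite mul0rz monalg.monalgU0.
Qed.

Lemma insubd_cycle G (c : chain R 1 X G) : boundary c = 0 ->
  chain_of_cycle (insubd (0 : cycle1 R X G) c) = c.
Proof. by move=> c0; rewrite insubdK //; apply/eqP. Qed.

Lemma hclassB G (c d : chain R 1 X G) : boundary c = 0 -> boundary d = 0 ->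
  hclass (c - d) = hclass c - hclass d.
Proof.
move=> c0 d0; rewrite /hclass.
have -> : insubd (0 : cycle1 R X G) (c - d) =
    insubd (0 : cycle1 R X G) c - insubd (0 : cycle1 R X G) d.
  apply: val_inj; rewrite raddfB /= !insubd_cycle //.
  by rewrite raddfB /= c0 d0 subrr.
exact: raddfB.
Qed.

Lemma hclassD G (c d : chain R 1 X G) :
  boundary c = 0 -> boundary d = 0 -> hclass (c + d) = hclass c + hclass d.
Proof.
move=> c0 d0; have dN : boundary (- d) = 0 by rewrite raddfN /= d0 oppr0.
have h0 : hclass (0 : chain R 1 X G) = 0.
  by rewrite -(subrr 0) hclassB ?raddf0 // subrr.
rewrite -[d in LHS]opprK hclassB // -[in LHS](sub0r d) hclassB ?raddf0 // h0.
by rewrite sub0r opprK.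
Qed.

(** Equality in the quotient, made usable: two cycles are homologous exactly when
    some 2-chain fills their difference. *)
Lemma hclassP G (c d : chain R 1 X G) : boundary c = 0 -> boundary d = 0 ->
  hclass c = hclass d <-> exists e : chain R 2 X G, boundary e = c - d.
Proof.
move=> c0 d0; rewrite /hclass.
set x := insubd _ c; set y := insubd _ d.
have -> : (exists e : chain R 2 X G, boundary e = c - d) <-> (x - y \in @is_boundary R X G).
  rewrite unfold_in asboolE.
  have -> : chain_of_cycle (x - y) = chain_of_cycle x - chain_of_cycle y.
    exact: (raddfB (val : cycle1 R X G -> chain R 1 X G)).
  by rewrite !insubd_cycle.
by split=> [/eqP|xy]; [|apply/eqP]; rewrite eqmodE.
Qed.

Lemma hclass_repr G (h : H1 R X G) : hclass (chain_of_cycle (repr h)) = h.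
Proof.
rewrite /hclass -[RHS]reprK; congr \pi_(_)%qT.
by apply: val_inj; rewrite insubdK //; exact: valP.
Qed.

Lemma boundary_repr G (h : H1 R X G) : boundary (chain_of_cycle (repr h)) = 0.
Proof. by apply/eqP; exact: (valP (repr h)). Qed.

Definition push_coef G G' (phi : G -> G') n (c : chain R n X G) : chain R n X G' :=
  extend_by_sum (fun (s : singular R n X) (z : G) => simplex s (phi z)) c.
Arguments push_coef {G G'} phi {n}.

Section PushCoef.
Variables (G G' : zmodType) (phi : {additive G -> G'}).

Lemma push_coefB n : {morph @push_coef G G' phi n : c d / c - d}.
Proof. by apply: extend_by_sumB => k x y; rewrite !raddfB. Qed.

HB.instance Definition _ n :=
  GRing.isZmodMorphism.Build _ _ (@push_coef G G' phi n) (@push_coefB n).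

Lemma push_coef_simplex n (s : singular R n X) x :
  push_coef phi (simplex s x) = simplex s (phi x).
Proof. by rewrite /push_coef extend_by_sumU // !raddf0. Qed.

(** Both sides are additive, so it is enough to compare them on one simplex, where
    pushing coefficients forward leaves the faces alone. *)
Lemma boundary_push_coef n (c : chain R n.+1 X G) :
  boundary (push_coef phi c) = push_coef phi (boundary c).
Proof.
apply: (chain_morph_eq (f := @boundary R n X G' \o push_coef phi)
  (g := push_coef phi \o @boundary R n X G)) => s x /=.
rewrite push_coef_simplex !boundary_simplex raddf_sum; apply: eq_bigr => i _.
by rewrite [RHS]push_coef_simplex raddfMz.
Qed.

(** [Defs.coef_map] acts on a chosen representative of a class; any other cycle of
    that class gives the same result, since filling 2-chains are pushed forward
    too. *)
Lemma coef_map_hclass (c : chain R 1 X G) : boundary c = 0 ->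
  Defs.coef_map phi (hclass c) = hclass (push_coef phi c).
Proof.
move=> c0; rewrite /Defs.coef_map -/(push_coef phi _).
have d0 := boundary_repr (hclass c).
have [e ecd] := (hclassP c0 d0).1 (esym (hclass_repr _)).
apply/esym/hclassP.
- by rewrite boundary_push_coef c0 raddf0.
- by rewrite boundary_push_coef d0 raddf0.
- by exists (push_coef phi e); rewrite boundary_push_coef ecd raddfB.
Qed.

Lemma coef_mapB : {morph @Defs.coef_map R X G G' phi : g h / g - h}.
Proof.
move=> g h; rewrite -(hclass_repr g) -(hclass_repr h).
have [g0 h0] := (boundary_repr g, boundary_repr h).
rewrite -hclassB // !coef_map_hclass //; last by rewrite raddfB /= g0 h0 subrr.
by rewrite raddfB hclassB // boundary_push_coef ?g0 ?h0 raddf0.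
Qed.

End PushCoef.

End Homology.

Section HalfPowers.
Variables (R : realType) (X : topologicalType).
Local Notation H := (H1 R X int).

Lemma hpowBl (g h : H) (n : halfint) : hpow (g - h) n = hpow g n - hpow h n.
Proof. exact: (@coef_mapB R X int halfint (intmul n)). Qed.

Lemma hpowBr (g : H) : {morph hpow g : m n / m - n}.
Proof.
move=> m n; rewrite -(hclass_repr g); have c0 := boundary_repr g.
rewrite /hpow !(@coef_map_hclass R X int halfint (intmul _) _ c0).
rewrite -hclassB; last 2 first.
- by rewrite boundary_push_coef boundary_repr raddf0.
- by rewrite boundary_push_coef boundary_repr raddf0.
congr hclass; rewrite /push_coef /extend_by_sum -sumrB; apply: eq_bigr => k _.
by rewrite /= mulrzBl simplexB.
Qed.

HB.instance Definition _ (g : H) :=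
  GRing.isZmodMorphism.Build halfint (H1 R X halfint) (@hpow R X g) (hpowBr g).

Lemma prB : {morph @pr R X : c d / c - d}.
Proof. by apply: extend_by_sumB => g m n; rewrite raddfB. Qed.

HB.instance Definition _ :=
  GRing.isZmodMorphism.Build (half_comb H) (H1 R X halfint) (@pr R X) prB.

Lemma pr_formal (n : halfint) (g : H) : pr (formal n g) = hpow g n.
Proof. by rewrite /pr extend_by_sumU // raddf0. Qed.

Lemma pr_formalB (n : halfint) (g h : H) :
  pr (formal n g - formal n h) = hpow (g - h) n.
Proof.
rewrite hpowBl -(pr_formal n g) -(pr_formal n h).
exact: prB.
Qed.

Lemma pr_sum_formalB (T : choiceType) (A : set T) (g h : T -> H) (n : halfint) :
  finite_set A ->
  pr (\sum_(v \in A) (formal n (g v) - formal n (h v))) =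
  \sum_(v \in A) hpow (g v - h v) n.
Proof.
move=> finA; rewrite !fsbig_finite //= raddf_sum.
by apply: eq_bigr => v _; exact: pr_formalB.
Qed.

(** The shape of the invariant S: the family indexed by v carries the double
    points, the terms with exponents c and d the positive and negative cusps. *)
Lemma pr_sum_formalB3 (T : choiceType) (A : set T) (g h : T -> H) (n c d : halfint)
    (x y z : H) : finite_set A ->
  pr (\sum_(v \in A) (formal n (g v) - formal n (h v)) +
      (formal c x - formal c y) + (formal d z - formal d 0)) =
  \sum_(v \in A) hpow (g v - h v) n + hpow (x - y) c + hpow z d.
Proof.
move=> finA; rewrite -(pr_sum_formalB g h n finA) -pr_formalB -[in RHS](subr0 z) -pr_formalB.
have prD (a b : half_comb H) : pr (a + b) = pr a + pr b by exact: raddfD.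
by rewrite -!prD.
Qed.

End HalfPowers.

(** * Affine simplices, concatenation and homotopy *)

Section Paths.
Variables (R : realType) (X : topologicalType).

Lemma set_val_coord_continuous n (i : 'I_n.+1) :
  continuous (fun x : @std_simplex R n => (set_val x : 'rV[R]_n.+1) 0 i).
Proof.
move=> x; apply: (@continuous_comp _ _ _ set_val (fun s : 'rV[R]_n.+1 => s 0 i)).
  exact: initial_continuous.
exact: coord_continuous.
Qed.

(** The affine map from the simplex to the plane whose values at the vertices are
    the points (f i, g i). *)
Definition affine n (f g : 'I_n.+1 -> R) (x : @std_simplex R n) : R * R :=
  (\sum_i f i * (set_val x : 'rV[R]_n.+1) 0 i,
   \sum_i g i * (set_val x : 'rV[R]_n.+1) 0 i).

Lemma affine_continuous n (f g : 'I_n.+1 -> R) : continuous (@affine n f g).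
Proof.
have lin (h : 'I_n.+1 -> R) : continuous
    (fun x : @std_simplex R n => \sum_i h i * (set_val x : 'rV[R]_n.+1) 0 i).
  have Fc i : xpredT i ->
      continuous (fun y : @std_simplex R n => h i * (set_val y : 'rV[R]_n.+1) 0 i).
    by move=> _ x; exact: (cvgM (cvg_cst _) (@set_val_coord_continuous n i x)).
  by have := continuous_big (@add_continuous R) (r := index_enum _) Fc.
by move=> x; exact: (cvg_pair (lin f x) (lin g x)).
Qed.
HB.instance Definition _ n f g :=
  isContinuous.Build _ _ (@affine n f g) (@affine_continuous n f g).

(** The i-th face omits the i-th vertex, so its vertices are listed by [lift i]. *)
Lemma affine_face n (f g : 'I_n.+2 -> R) (i : 'I_n.+2) (x : @std_simplex R n) :
  affine f g (face i x) = affine (f \o lift i) (g \o lift i) x.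
Proof.
have lin (h : 'I_n.+2 -> R) : \sum_j h j * (set_val (face i x) : 'rV[R]_n.+2) 0 j =
    \sum_j (h \o lift i) j * (set_val x : 'rV[R]_n.+1) 0 j.
  rewrite (bigD1_ord i) //= set_valE /= mxE unlift_none mulr0 add0r.
  by apply: eq_bigr => j _; rewrite mxE liftK.
by rewrite /affine !lin.
Qed.

Definition affine_simplex n (G : continuousType (R * R)%type X) (f g : 'I_n.+1 -> R) :
    chain R n X int := simplex (G \o affine f g : singular R n X) 1.

Lemma boundary_affine_simplex n (G : continuousType (R * R)%type X) (f g : 'I_n.+2 -> R) :
  boundary (affine_simplex G f g) =
  \sum_(i < n.+2) affine_simplex G (f \o lift i) (g \o lift i) *~ ((-1) ^+ i).
Proof.
have fE i : (G \o affine f g : singular R n.+1 X) \o @face R n i =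
    G \o affine (f \o lift i) (g \o lift i) :> singular R n X.
  by apply/continuousEP => x; exact: congr1 (affine_face f g i x).
rewrite /affine_simplex boundary_simplex; apply: eq_bigr => i _.
by rewrite fE raddfMz.
Qed.

Definition segment (G : continuousType (R * R)%type X) (p q : R * R) : chain R 1 X int :=
  affine_simplex G (fun i : 'I_2 => nth 0 [:: p.1; q.1] i)
                   (fun i : 'I_2 => nth 0 [:: p.2; q.2] i).

Lemma boundary_triangle (G : continuousType (R * R)%type X) (p q r : R * R) :
  exists e, boundary e = segment G p q + segment G q r - segment G p r.
Proof.
exists (affine_simplex G (fun i : 'I_3 => nth 0 [:: p.1; q.1; r.1] i)
                         (fun i : 'I_3 => nth 0 [:: p.2; q.2; r.2] i)).
rewrite boundary_affine_simplex !big_ord_recl big_ord0 addr0.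
rewrite expr0 expr1 expr2 mulN1r opprK mulr1z mulrN1z.
rewrite [RHS]addrAC [RHS]addrC [in RHS](addrC (segment G p q)).
have eqF (f g f' g' : 'I_2 -> R) : f =1 f' -> g =1 g' ->
  affine_simplex G f g = affine_simplex G f' g' by move=> /funext -> /funext ->.
by rewrite /segment; congr (_ + _); last congr (- _ + _);
  apply: eqF => -[[|[|]]].
Qed.

Lemma edge_segment (G : continuousType (R * R)%type X) (g : continuousType R X) s a b :
  (forall t, g t = G (s, t)) -> edge g a b = segment G (s, a) (s, b).
Proof.
move=> gG; rewrite /edge /segment -/(simplex _ _); congr simplex.
apply/continuousEP => x /=; rewrite gG; congr (G _); rewrite /edge_param /affine.
have [_] := set_valP x; rewrite !big_ord_recl !big_ord0 /= !addr0.
set u := _ 0 _; set v := _ 0 _; set w := _ 0 1.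
have -> : w = v by congr (_ 0 _); exact: val_inj.
by move=> uv; rewrite -[u](addrK v) uv; congr (_, _); ring.
Qed.

Lemma edge_shift (g h : continuousType R X) a b c :
  (forall t, g t = h (t + c)) -> edge g a b = edge h (a + c) (b + c).
Proof.
move=> gh; rewrite /edge -!/(simplex _ _); congr simplex.
by apply/continuousEP => x /=; rewrite gh /edge_param; congr (h _); ring.
Qed.

(** The degenerate triangle with vertices a, b, c on the line, mapped by g. *)
Lemma edge_cat (g : continuousType R X) a b c :
  exists e, boundary e = edge g a b + edge g b c - edge g a c.
Proof.
have snd_c : continuous (fun p : R * R => g p.2).
  by move=> p; apply: (@continuous_comp _ _ _ snd g); [exact: cvg_snd|exact: cts_fun].
have gE t : g t = mkcts snd_c (0, t) by [].
by rewrite !(edge_segment _ _ gE); exact: boundary_triangle.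
Qed.

Definition vertex (x : X) : chain R 0 X int :=
  simplex (mkcts (@cst_continuous (@std_simplex R 0) X x)) 1.

Lemma boundary_edge (g : continuousType R X) a b :
  boundary (edge g a b) = vertex (g b) - vertex (g a).
Proof.
rewrite /edge -/(simplex _ _) boundary_simplex !big_ord_recl big_ord0 /= addr0.
rewrite expr0 expr1 mulrN1z raddfN /=.
have sx (s s' : singular R 0 X) : s =1 s' -> simplex s 1 = simplex s' 1 :> chain R 0 X int.
  by move=> /continuousEP ->.
congr (_ - _); apply: sx => x /=; rewrite /mkcts /edge_param; congr (g _);
  have [_] := set_valP x; rewrite big_ord_recl big_ord0 addr0 => x1;
  rewrite set_valE /= mxE.
  have -> : 1 = lift ord0 0 :> 'I_2 by exact: val_inj.
  by rewrite liftK x1 mulr1 addrC subrK.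
have -> : 1 = lift ord0 0 :> 'I_2 by exact: val_inj.
by rewrite unlift_none mulr0 addr0.
Qed.

Lemma boundary_loop (g : continuousType R X) a b : g a = g b -> boundary (edge g a b) = 0.
Proof. by move=> gab; rewrite boundary_edge gab subrr. Qed.

Lemma eq_boundary_edge (g : continuousType R X) a b b' : g b = g b' ->
  boundary (edge g a b) = boundary (edge g a b').
Proof. by move=> gb; rewrite !boundary_edge gb. Qed.

(** The rectangle between the two loops is cut into two triangles along a diagonal.
    Their boundaries cancel along the diagonal, and the remaining vertical sides
    have the same image because each intermediate curve is closed. *)
Lemma homotopic_loops (H : continuousType (R * R)%type X) (g h : continuousType R X)
    s0 s1 a b :
  (forall t, g t = H (s0, t)) -> (forall t, h t = H (s1, t)) ->
  (forall s, H (s, a) = H (s, b)) ->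
  hclass (edge g a b) = hclass (edge h a b).
Proof.
move=> gH hH Hab; apply/hclassP.
- by rewrite boundary_loop // !gH.
- by rewrite boundary_loop // !hH.
have [e ee] := boundary_triangle H (s0, a) (s0, b) (s1, b).
have [d de] := boundary_triangle H (s0, a) (s1, a) (s1, b).
exists (e - d); rewrite raddfB /= ee de (edge_segment _ _ gH) (edge_segment _ _ hH).
have -> : segment H (s0, b) (s1, b) = segment H (s0, a) (s1, a).
  rewrite /segment; congr simplex; apply/continuousEP => x /=; rewrite /affine.
  have [_] := set_valP x; rewrite !big_ord_recl !big_ord0 /= !addr0 => uv.
  by rewrite -!mulrDr uv !mulr1 Hab.
by rewrite opprB addrA subrK opprD addrA addrK.
Qed.

End Paths.

(** * Rotations and linear maps of the plane *)

Section Plane.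
Variable R : realType.
Notation plane := 'rV[R]_2.
Implicit Types u v w : plane.

Lemma eucl_normalize u : u != 0 -> eucl (normalize u) = 1.
Proof.
move=> u0; have e0 : eucl u != 0 by apply: contra_neq u0; exact: eucl_eq0.
have dotu : dot (normalize u) (normalize u) = (eucl u)^-1 ^+ 2 * dot u u.
  by rewrite /dot !mxE; ring.
rewrite {1}/eucl dotu sqrtrM ?sqr_ge0 // sqrtr_sqr ger0_norm ?invr_ge0 ?sqrtr_ge0 //.
exact: mulVf.
Qed.

Lemma eucl_ge0 u : 0 <= eucl u. Proof. exact: sqrtr_ge0. Qed.

Lemma euclZ k u : eucl (k *: u) = `|k| * eucl u.
Proof.
rewrite /eucl; have -> : dot (k *: u) (k *: u) = k ^+ 2 * dot u u.
  by rewrite /dot !mxE; ring.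
by rewrite sqrtrM ?sqr_ge0 // sqrtr_sqr.
Qed.

Lemma normalizeZ k u : 0 < k -> normalize (k *: u) = normalize u.
Proof.
move=> k0; rewrite /normalize euclZ gtr0_norm // invfM scalerA.
by rewrite mulrAC mulVf ?gt_eqF // mul1r.
Qed.

Lemma normalize_unit u : eucl u = 1 -> normalize u = u.
Proof. by move=> u1; rewrite /normalize u1 invr1 scale1r. Qed.

Lemma eucl_neq0 u : (eucl u != 0) = (u != 0).
Proof.
apply/idP/idP; apply: contra_neq; last exact: eucl_eq0.
by move=> ->; rewrite -(scale0r 0) euclZ normr0 mul0r.
Qed.

Lemma ord2_cases (j : 'I_2) : j = 0 \/ j = 1.
Proof. by case: j => -[|[|//]] lt_j; [left|right]; exact: val_inj. Qed.

Lemma eq_plane u v : u 0 0 = v 0 0 -> u 0 1 = v 0 1 -> u = v.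
Proof.
move=> e0 e1; apply/rowP => j.
by have [->|->] := ord2_cases j.
Qed.

Lemma rotateD s t u : rotate (s + t) u = rotate s (rotate t u).
Proof. by apply: eq_plane; rewrite !mxE /= cosD sinD; ring. Qed.

Lemma rotateZ t k u : rotate t (k *: u) = k *: rotate t u.
Proof. by apply: eq_plane; rewrite !mxE /=; ring. Qed.

Lemma rotate0 u : rotate 0 u = u.
Proof. by apply: eq_plane; rewrite !mxE /= cos0 sin0; ring. Qed.

Lemma rotate2pi u : rotate (pi *+ 2) u = u.
Proof. by apply: eq_plane; rewrite !mxE /= cos2pi sin2pi; ring. Qed.

Lemma rotate_neq0 t u : (rotate t u != 0) = (u != 0).
Proof. by rewrite -!eucl_neq0 eucl_rotate. Qed.

Lemma angle_exists (x y : R) : x ^+ 2 + y ^+ 2 = 1 ->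
  exists2 t, - pi < t <= pi & cos t = x /\ sin t = y.
Proof.
move=> xy1; have x1 : -1 <= x <= 1.
  by rewrite -ler_norml -(@expr_le1 _ 2) // real_normK ?num_real // -xy1 lerDl sqr_ge0.
have sx : sin (acos x) = `|y| by rewrite sin_acos // -xy1 addrAC subrr add0r sqrtr_sqr.
have cx : cos (acos x) = x by rewrite acosK // in_itv.
have a0 := acos_ge0 x1; have api := acos_lepi x1.
have [y0|y0] := leP 0 y.
  exists (acos x); last by rewrite cx sx ger0_norm.
  by rewrite api andbT (lt_le_trans _ a0) // oppr_lt0 pi_gt0.
exists (- acos x); last by rewrite cosN sinN cx sx ltr0_norm ?opprK.
rewrite ltrN2 lt_neqAle api andbT (le_trans _ (pi_ge0 R)) ?oppr_le0 // andbT.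
apply: contraTneq y0 => apie; rewrite -leNgt.
by move: sx; rewrite apie sinpi => /esym/eqP; rewrite normr_eq0 => /eqP ->.
Qed.

Lemma dot_det2_sqr u v : dot u v ^+ 2 + det2 u v ^+ 2 = dot u u * dot v v.
Proof. by rewrite /dot /det2; ring. Qed.

Lemma dot_eucl u : dot u u = eucl u ^+ 2.
Proof. by rewrite sqr_sqrtr // /dot -!expr2 addr_ge0 ?sqr_ge0. Qed.

(** For unit vectors the inner product and the determinant are the cosine and the
    sine of the angle from the first to the second; they determine the rotation. *)
Lemma rotate_between u v : eucl u = 1 -> eucl v = 1 ->
  exists t, [/\ - pi < t <= pi, v = rotate t u & sin t = det2 u v].
Proof.
move=> u1 v1; have [|t tpi [ct st]] := @angle_exists (dot u v) (det2 u v).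
  by rewrite dot_det2_sqr !dot_eucl u1 v1 !expr1n mulr1.
exists t; split=> //.
have := dot_eucl u; rewrite u1 expr1n /dot => uu.
apply: eq_plane; rewrite !mxE /= ct st /dot /det2.
  rewrite -[LHS](mulr1) -uu; ring.
rewrite -[LHS](mulr1) -uu; ring.
Qed.

Lemma rotate_scale_between u v : u != 0 -> v != 0 ->
  exists t k, 0 < k /\ v = k *: rotate t u.
Proof.
move=> u0 v0.
have [t [_ vE _]] := rotate_between (eucl_normalize u0) (eucl_normalize v0).
have eu : 0 < eucl u by rewrite lt_neqAle eq_sym eucl_neq0 u0 eucl_ge0.
have ev : 0 < eucl v by rewrite lt_neqAle eq_sym eucl_neq0 v0 eucl_ge0.
exists t, (eucl v / eucl u); split; first by rewrite divr_gt0.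
rewrite -scalerA -rotateZ -/(normalize u) -vE scalerA mulfV ?scale1r //.
by rewrite gt_eqF.
Qed.

Lemma mulmx_unit_neq0 u (M : 'M[R]_2) : M \in unitmx -> u != 0 -> u *m M != 0.
Proof.
move=> Mu; apply: contra_neq => uM0; by rewrite -(mulmxK Mu u) uM0 mul0mx.
Qed.

Lemma det_mx2 (A : 'M[R]_2) : \det A = A 0 0 * A 1 1 - A 0 1 * A 1 0.
Proof.
rewrite (expand_det_row _ 0) !big_ord_recl big_ord0 addr0 /cofactor /=.
rewrite !det_mx11 !mxE /= expr0 mul1r expr1 mulN1r mulrN.
by congr (A _ _ * A _ _ - A _ _ * A _ _); exact: val_inj.
Qed.

Lemma mulmx2E u (M : 'M[R]_2) j : (u *m M) 0 j = u 0 0 * M 0 j + u 0 1 * M 1 j.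
Proof.
rewrite mxE big_ord_recl big_ord1.
by congr (_ + u 0 _ * M _ j); exact: val_inj.
Qed.

(** The part of M that commutes with rotations; as a map of the complex line, M is
    the sum of a linear part, which is this one, and of an antilinear part. *)
Definition conformal (M : 'M[R]_2) : 'M[R]_2 :=
  \matrix_(i, j) if i == j then (M 0 0 + M 1 1) / 2
                 else if i == 0 then (M 0 1 - M 1 0) / 2 else (M 1 0 - M 0 1) / 2.

(** The determinant is the square of the modulus of the conformal part minus that
    of the anticonformal part, and shrinking the latter can only increase it. *)
Lemma det_conformal (M : 'M[R]_2) (k : R) : 0 < \det M -> `|k| <= 1 ->
  0 < \det (conformal M + k *: (M - conformal M)).
Proof.
rewrite !det_mx2 !mxE /= => M0 k1.
have k2 : 0 <= 1 - k ^+ 2 by rewrite subr_ge0 -(real_normK (num_real k)) expr_le1.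
pose e := ((M 0 0 - M 1 1) / 2) ^+ 2 + ((M 0 1 + M 1 0) / 2) ^+ 2.
have e0 : 0 <= (1 - k ^+ 2) * e by rewrite mulr_ge0 // addr_ge0 ?sqr_ge0.
by apply: (lt_le_trans M0); rewrite -subr_ge0; apply: (le_trans e0); rewrite /e; lra.
Qed.

Lemma rotate_conformal (M : 'M[R]_2) t u :
  rotate t u *m conformal M = rotate t (u *m conformal M).
Proof.
have rotE v : rotate t v 0 0 = cos t * v 0 0 - sin t * v 0 1 by rewrite mxE.
have rotE1 v : rotate t v 0 1 = sin t * v 0 0 + cos t * v 0 1 by rewrite mxE.
by apply: eq_plane; rewrite !(rotE, rotE1, mulmx2E) !mxE /=; ring.
Qed.

Lemma continuous_plane (T : topologicalType) (f : T -> plane) :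
  continuous (fun s => f s 0 0) -> continuous (fun s => f s 0 1) -> continuous f.
Proof.
move=> f0 f1 s; apply: continuous_mx_at => i j; rewrite (ord1 i).
by have [->|->] := ord2_cases j; [exact: f0|exact: f1].
Qed.

Lemma rotate_continuous2 (T : topologicalType) (a : T -> R) (u : T -> plane) :
  continuous a -> continuous u -> continuous (fun s => rotate (a s) (u s)).
Proof.
move=> ac uc.
have cc : continuous (cos \o a) by move=> s; exact: (continuous_comp (ac s) (@continuous_cos R _)).
have sc : continuous (sin \o a) by move=> s; exact: (continuous_comp (ac s) (@continuous_sin R _)).
have uic i : continuous (fun s => u s 0 i).
  move=> s; apply: (@continuous_comp _ _ _ u (fun v : plane => v 0 i)); first exact: uc.
  exact: coord_continuous.
apply: continuous_plane => s.
  rewrite (_ : (fun _ => _) = fun s => cos (a s) * u s 0 0 - sin (a s) * u s 0 1); last first.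
    by apply/funext => ?; rewrite mxE.
  exact: (cvgB (cvgM (cc s) (uic 0 s)) (cvgM (sc s) (uic 1 s))).
rewrite (_ : (fun _ => _) = fun s => sin (a s) * u s 0 0 + cos (a s) * u s 0 1); last first.
  by apply/funext => ?; rewrite mxE.
exact: (cvgD (cvgM (sc s) (uic 0 s)) (cvgM (cc s) (uic 1 s))).
Qed.

End Plane.

(** * The homology class of a fiber *)

(** The level sets of a locally constant function are open and closed. *)
Lemma locally_constant_connected (T : topologicalType) (Y : Type) (f : T -> Y) :
  connected [set: T] -> (forall p, \forall q \near p, f p = f q) ->
  forall p q, f p = f q.
Proof.
move=> cT fl p q; pose A := [set r | f p = f r].
suff AT : A = setT by have : A q by rewrite AT.
apply: cT; first by exists p.
- exists A; last by rewrite setTI.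
  by rewrite openE => r Ar; apply: filterS (fl r) => r' rr'; rewrite /A /= -rr'.
- exists A; last by rewrite setTI.
  rewrite -(setCK A); apply: open_closedC; rewrite openE => r Ar.
  by apply: filterS (fl r) => r' rr' Ar'; apply: Ar; rewrite /A /= rr'.
Qed.

Section Fibers.
Variables (R : realType) (F : surface R).
Notation plane := 'rV[R]_2.
Implicit Types (p q : F) (xi eta : STF F).

Lemma base_continuous : continuous (@base R F).
Proof.
apply/continuousP => U oU.
suff oV : STF_open (@base R F @^-1` U) by exact: oV.
move=> q xi _ Uxi; exists U, setT; split; last by [].
  exact: open_nbhs_nbhs.
exact: filterT.
Qed.

(** An open set of contact elements has open traces in every trivialization, so to
    test continuity at a point a single trivialization is enough. *)
Lemma STF_continuous_at (T : topologicalType) (g : T -> STF F) (t : T) q :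
  dom (chart_at q) (base (g t)) -> {for t, continuous (@base R F \o g)} ->
  {for t, continuous (comps q \o g)} -> {for t, continuous g}.
Proof.
move=> dq cb cc A; rewrite nbhsE => -[B [oB Bgt] BA].
have [U [W [nU nW UWB]]] := oB q (g t) dq Bgt.
apply: (@filterS _ (nbhs t) _ ((@base R F \o g) @^-1` U `&` (comps q \o g) @^-1` W)).
  by move=> s [Us Ws]; apply: BA; exact: UWB.
by apply: filterI; [exact: cb|exact: cc].
Qed.

(** The matrix that takes the components of a covector at p in the chart singled
    out at p to its components in the chart at q. *)
Definition transition q p : 'M[R]_2 :=
  ('J (coords (chart_at p) \o param (chart_at q)) (coords (chart_at q) p))^T.

Lemma transition_det q p : dom (chart_at q) p -> 0 < \det (transition q p).
Proof.
move=> dq; rewrite det_tr; have [_] := chart_compat q p; apply; exists p => //.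
by split=> //; exact: mem_chart_at.
Qed.

Lemma transition_unit q p : dom (chart_at q) p -> transition q p \in unitmx.
Proof. by move=> /transition_det d0; rewrite unitmxE unitfE gt_eqF. Qed.

(** The change of coordinates from a chart to itself is the identity on an open
    set, hence has the identity as derivative there. *)
Lemma transition_id p : transition p p = 1%:M.
Proof.
set c := chart_at p; set x := coords c p.
have xc : (coords c @` dom c) x by exists p => //; exact: mem_chart_at.
have idx : \near x, (coords c \o param c) x = x.
  near=> y; have [z dz <-] : (coords c @` dom c) y.
    by near: y; apply: open_nbhs_nbhs; split=> //; exact: range_open.
  by rewrite /= coordsK.
have [smooth _] := chart_compat p p.
have dif : differentiable (coords c \o param c) x.
  by apply: (smooth [::]); exists p => //; split; exact: mem_chart_at.
rewrite /transition -/c -/x -[RHS]trmx1; congr trmx; apply/row_matrixP => i.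
rewrite !rowE -deriveEjacobian // mulmx1.
by rewrite (near_eq_derive _ idx) derive_id.
Unshelve. all: by end_near. Qed.

Lemma compsE q xi : comps q xi = normalize (codir xi *m transition q (base xi)).
Proof. by []. Qed.

Lemma comps_base xi : comps (base xi) xi = codir xi.
Proof. by rewrite compsE transition_id mulmx1 normalize_unit ?codir_unit. Qed.

Lemma eq_STF xi eta : base xi = base eta -> codir xi = codir eta -> xi = eta.
Proof.
case: xi eta => [p u u1] [p' u' u1'] /= pp uu; case: _ / pp; case: _ / uu in u1' *.
congr ContactElement; exact: Prop_irrelevance.
Qed.

(** The value on the zero vector is arbitrary; it makes [element] total. *)
Definition unitize (u : plane) : plane :=
  if u == 0 then delta_mx 0 0 else normalize u.

Lemma eucl_unitize u : eucl (unitize u) = 1.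
Proof.
rewrite /unitize; case: eqVneq => [_|]; last exact: eucl_normalize.
by rewrite /eucl /dot !mxE /= mulr0 addr0 mulr1 sqrtr1.
Qed.

(** The inverse of the trivialization over the chart at q: the contact element at
    p with components proportional to w in that chart. *)
Definition element q p (w : plane) : STF F :=
  @ContactElement R F p (unitize (w *m invmx (transition q p))) (eucl_unitize _).

Lemma comps_element q p w : dom (chart_at q) p -> w != 0 ->
  comps q (element q p w) = normalize w.
Proof.
move=> dq w0; have Mu := transition_unit dq.
rewrite compsE /= /unitize ifF; last first.
  by apply/negbTE; apply: mulmx_unit_neq0; rewrite ?unitmx_inv.
rewrite /normalize -scalemxAl mulmxKV // -/(normalize w).
rewrite -/(normalize _) normalizeZ // invr_gt0 lt_neqAle eucl_ge0 eq_sym eucl_neq0 andbT.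
by apply: mulmx_unit_neq0; rewrite ?unitmx_inv.
Qed.

Lemma elementZ q p k w : 0 < k -> element q p (k *: w) = element q p w.
Proof.
move=> k0; apply: eq_STF => //=; rewrite -scalemxAl /unitize normalizeZ //.
by rewrite scaler_eq0 gt_eqF.
Qed.

Lemma element_transition q xi : dom (chart_at q) (base xi) ->
  element q (base xi) (codir xi *m transition q (base xi)) = xi.
Proof.
move=> dq; apply: eq_STF => //=; rewrite mulmxK ?transition_unit // /unitize.
rewrite ifF ?normalize_unit ?codir_unit //.
by apply/negbTE; rewrite -eucl_neq0 codir_unit oner_neq0.
Qed.

Lemma element_continuous (T : topologicalType) q (x : T -> plane) (w : T -> plane) :
  (forall s, (coords (chart_at q) @` dom (chart_at q)) (x s)) ->
  (forall s, w s != 0) -> continuous x -> continuous w ->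
  continuous (fun s => element q (param (chart_at q) (x s)) (w s)).
Proof.
move=> xD w0 xc wc t; set c := chart_at q.
have pD s : dom c (param c (x s)) by have [p dp <-] := xD s; rewrite coordsK.
apply: (@STF_continuous_at _ _ _ q).
- exact: pD.
- apply: (@continuous_comp _ _ _ x (param c)); first exact: xc.
  by apply: param_continuous; exact: xD.
- rewrite (_ : _ \o _ = fun s => normalize (w s)); last first.
    by apply/funext => s /=; rewrite comps_element.
  apply: (@continuous_comp _ _ _ w (@normalize R)); first exact: wc.
  exact: normalize_continuous.
Qed.

(** A family of loops in the trivialization over one chart, above the moving base
    point x s. The parameter runs from 0 to pi / 2, so that sines and cosines of
    it interpolate between 0 and 1 while staying bounded for all s; thus the
    family is defined on the whole plane, as [homotopic_loops] requires. *)
Lemma fiber_homotopy q (x : R -> plane) (w : R -> R -> plane) (g h : continuousType R (STF F)) :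
  (forall s, (coords (chart_at q) @` dom (chart_at q)) (x s)) ->
  (forall s t, w s t != 0) -> continuous x ->
  continuous (fun st : R * R => w st.1 st.2) ->
  (forall s, w s 0 = w s (pi *+ 2)) ->
  (forall t, g t = element q (param (chart_at q) (x 0)) (w 0 t)) ->
  (forall t, h t = element q (param (chart_at q) (x (pi / 2))) (w (pi / 2) t)) ->
  hclass (edge g 0 (pi *+ 2)) = hclass (edge h 0 (pi *+ 2)).
Proof.
move=> xD w0 xc wc wper gE hE.
have xc1 : continuous (fun st : R * R => x st.1).
  by move=> st; apply: (@continuous_comp _ _ _ fst x); [exact: cvg_fst|exact: xc].
have Hc := @element_continuous _ q (fun st : R * R => x st.1)
  (fun st => w st.1 st.2) (fun st => xD st.1) (fun st => w0 st.1 st.2) xc1 wc.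
apply: (homotopic_loops (H := mkcts Hc) gE hE) => s.
by rewrite -[LHS]/(element q (param (chart_at q) (x s)) (w s 0)) wper.
Qed.


(** Read in the chart at q, the fiber through xi is the image of a rotating vector
    under the transition matrix M. Replacing M by K + cos s (M - K), where K is
    the conformal part of M, keeps the determinant positive and leads at
    s = pi / 2 to K, which commutes with rotations. *)
Lemma fiber_class_conformal q xi : dom (chart_at q) (base xi) ->
  exists (u : plane) (g : continuousType R (STF F)),
    [/\ u != 0, (forall t, g t = element q (base xi) (rotate t u)) &
        fiber_class xi = hclass (edge g 0 (pi *+ 2))].
Proof.
move=> dq; set p := base xi; set c := chart_at q.
set M := transition q p; set u := codir xi.
have M0 : 0 < \det M by exact: transition_det.
have u0 : u != 0 by rewrite -eucl_neq0 codir_unit oner_neq0.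
pose N (s : R) : 'M[R]_2 := conformal M + cos s *: (M - conformal M).
have N0 s : N s \in unitmx.
  by rewrite unitmxE unitfE gt_eqF // det_conformal // ler_norml cos_geN1 cos_le1.
have pD : (coords c @` dom c) (coords c p) by exists p.
have wc : continuous (fun st : R * R => rotate st.2 u *m N st.1).
  have fc : continuous (fun st : R * R => rotate st.2 u).
    by apply: rotate_continuous2 => st; [exact: cvg_snd|exact: cst_continuous].
  have cc : continuous (fun st : R * R => cos st.1).
    by move=> st; apply: (@continuous_comp _ _ _ fst cos); [exact: cvg_fst|exact: continuous_cos].
  move=> st; rewrite (_ : (fun _ => _) = fun st : R * R => rotate st.2 u *m conformal M +
      cos st.1 *: (rotate st.2 u *m (M - conformal M))); last first.
    by apply/funext => z; rewrite mulmxDr scalemxAr.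
  have mc (B : 'M[R]_2) : (fun st : R * R => rotate st.2 u *m B) @ st --> rotate st.2 u *m B.
    apply: (@continuous_comp _ _ _ (fun st : R * R => rotate st.2 u) (fun v : plane => v *m B)).
      exact: fc.
    exact: mulmx_continuous.
  exact: (cvgD (mc _) (cvgZ (cc st) (mc _))).
have w0 s t : rotate t u *m N s != 0.
  by apply: mulmx_unit_neq0; rewrite ?rotate_neq0.
have ec s : continuous (fun t => element q (param c (coords c p)) (rotate t u *m N s)).
  apply: (@element_continuous _ q (fun=> coords c p)) => //; first exact: cst_continuous.
  move=> t; apply: (@continuous_comp _ _ _ (fun t' => rotate t' u) (fun v : plane => v *m N s)).
    exact: rotate_continuous.
  exact: mulmx_continuous.
have N1 : N (pi / 2) = conformal M by rewrite /N cos_pihalf scale0r addr0.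
have N2 : N 0 = M by rewrite /N cos0 scale1r addrC subrK.
have gE s t : mkcts (ec s) t = element q p (rotate t u *m N s).
  by rewrite /mkcts coordsK.
exists (u *m conformal M), (mkcts (ec (pi / 2))); split.
- by rewrite -N1 mulmx_unit_neq0.
- by move=> t; apply: (etrans (gE _ t)); rewrite N1 rotate_conformal.
apply: (@fiber_homotopy q (fun=> coords c p) (fun s t => rotate t u *m N s)) => //.
- exact: cst_continuous.
- by move=> s; rewrite rotate2pi rotate0.
move=> t; rewrite N2 coordsK //.
exact: esym (element_transition (xi := turn xi t) dq).
Qed.

(** Two rotating vectors differ by a positive factor, which does not change the
    contact element, and by a phase t0: the base point moves along the segment
    while the phase grows from 0 to t0. The segment is extended symmetrically
    because sin s takes negative values as well. *)
Lemma fiber_class_chart q xi eta :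
  dom (chart_at q) (base xi) -> dom (chart_at q) (base eta) ->
  (forall s, `|s| <= 1 -> (coords (chart_at q) @` dom (chart_at q))
     (coords (chart_at q) (base xi) +
      s *: (coords (chart_at q) (base eta) - coords (chart_at q) (base xi)))) ->
  fiber_class xi = fiber_class eta.
Proof.
move=> dxi deta seg; set c := chart_at q in seg *.
have [u [g [u0 gE ->]]] := fiber_class_conformal dxi.
have [v [h [v0 hE ->]]] := fiber_class_conformal deta.
have [t0 [k [k0 vE]]] := rotate_scale_between u0 v0.
apply: (@fiber_homotopy q (fun s => coords c (base xi) +
      sin s *: (coords c (base eta) - coords c (base xi)))
  (fun s t => rotate (t + sin s * t0) u)).
- by move=> s; apply: seg; rewrite ler_norml sin_geN1 sin_le1.
- by move=> s t; rewrite rotate_neq0.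
- move=> s; apply: cvgD; first exact: cst_continuous.
  by apply: cvgZ; [exact: continuous_sin|exact: cst_continuous].
- apply: rotate_continuous2 => st; last exact: cst_continuous.
  apply: cvgD; first exact: cvg_snd.
  apply: cvgM; last exact: cst_continuous.
  by apply: (@continuous_comp _ _ _ fst sin); [exact: cvg_fst|exact: continuous_sin].
- by move=> s; rewrite add0r addrC rotateD rotate2pi.
- by move=> t; rewrite sin0 mul0r scale0r !addr0 coordsK.
- move=> t; rewrite sin_pihalf mul1r scale1r addrC subrK coordsK // hE vE.
  by rewrite rotateZ elementZ // rotateD.
Qed.

Lemma fiber_class_locally_constant p :
  \forall p' \near p, forall xi eta, base xi = p -> base eta = p' ->
    fiber_class xi = fiber_class eta.
Proof.
set c := chart_at p.
have dp : dom c p by exact: mem_chart_at.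
have : nbhs (coords c p) (coords c @` dom c).
  by apply: open_nbhs_nbhs; split; [exact: range_open|exists p].
move=> /nbhs_ballP[r /= r0 br].
have cp := coords_continuous dp.
near=> p' => xi eta xip etap.
have dp' : dom c p'.
  by near: p'; apply: open_nbhs_nbhs; split=> //; exact: dom_open.
apply: (@fiber_class_chart p) => [||s s1]; rewrite ?xip ?etap //.
apply: br; rewrite -ball_normE /= opprD addNKr normrN normrZ.
apply: (@le_lt_trans _ _ `|coords c p' - coords c p|); first by rewrite ler_piMl.
rewrite distrC; near: p'.
have := cp (ball (coords c p) r) (nbhsx_ballx _ _ r0).
by rewrite -ball_normE.
Unshelve. all: by end_near. Qed.

(** Along a fiber and near it the class does not change, so it induces a locally
    constant function on the base; [over] is an arbitrary choice of a contact
    element over each point. *)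
Lemma fiber_class_const xi eta : fiber_class xi = fiber_class eta.
Proof.
pose over p : STF F := element p p (delta_mx 0 0).
have over_eq zeta : fiber_class zeta = fiber_class (over (base zeta)).
  have /nbhs_singleton H := fiber_class_locally_constant (base zeta).
  exact: H.
rewrite (over_eq xi) (over_eq eta).
apply: (@locally_constant_connected F _ (fun p => fiber_class (over p))).
  exact: surface_connected.
by move=> p; apply: filterS (fiber_class_locally_constant p) => p'; apply.
Qed.

End Fibers.

(** * Real functions injective near a point *)

Section LocalInjectivity.
Variable R : realType.
Implicit Types (f df : R -> R) (a b s t : R).

Lemma near_interval (P : set R) a : (\forall x \near a, P x) ->
  exists2 r, 0 < r & forall x, a - r < x < a + r -> P x.
Proof.
move=> /nbhs_ballP[r /= r0 rP]; exists r => // x xar; apply: rP.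
by rewrite -ball_normE /= distrC ltr_distl.
Qed.

(** The mean value theorem without assuming s < t; the intermediate point is
    written as a convex combination so that it stays in the interval and its
    distance to s can be controlled. *)
Lemma mean_value f df a r s t :
  (forall x, a - r < x < a + r -> is_derive x 1 f (df x)) ->
  a - r < s < a + r -> a - r < t < a + r ->
  exists2 k, 0 < k < 1 & f t - f s = df (s + k * (t - s)) * (t - s).
Proof.
move=> fd.
wlog st : s t / s <= t => [wl sr tr|].
  have [/wl|/ltW ts] := leP s t; first exact.
  have [k k01 fts] := wl t s ts tr sr; exists (1 - k); first by lra.
  by rewrite -[LHS]opprB fts -mulrN opprB; congr (df _ * _); ring.
move=> sr tr; move: st; rewrite le_eqVlt => /predU1P[->|st].
  by exists (1 / 2); [lra|rewrite !subrr mulr0].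
have inr x : s <= x <= t -> a - r < x < a + r by move=> ?; lra.
have [x xs||c] := @MVT R f df s t st; rewrite ?in_itv /=.
- by apply: fd; apply: inr; move: xs; rewrite in_itv /=; lra.
- apply: derivable_within_continuous => x; rewrite in_itv /= => /inr /fd xd.
  exact: ex_derive.
move=> cst fts; have ts0 : t - s != 0 by lra.
exists ((c - s) / (t - s)); last first.
  by rewrite fts; congr (df _ * _); rewrite divfK // addrC subrK.
rewrite divr_gt0 ?ltr_pdivrMr ?mul1r; lra.
Qed.

Lemma widen_interval a m r s : m <= r -> a - m < s < a + m -> a - r < s < a + r.
Proof. by move=> ?; lra. Qed.

(** For the transversal case: two slope comparisons with exchanged roles are
    compatible only at the point itself. *)
Lemma mutually_doubled_eq0 s t : `|s| *+ 2 <= `|t| -> `|t| *+ 2 <= `|s| -> s = 0 /\ t = 0.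
Proof.
move=> h1 h2; have s0 := normr_ge0 s; have t0 := normr_ge0 t.
by rewrite !mulr2n in h1 h2; split; apply/eqP; rewrite -normr_eq0; apply/eqP; lra.
Qed.

Definition locally_injective f a := exists2 r, 0 < r &
  forall s t, a - r < s < a + r -> a - r < t < a + r -> f s = f t -> s = t.

Lemma regular_locally_injective f df a : df a != 0 -> {for a, continuous df} ->
  (\forall x \near a, is_derive (x : R) (1 : R) f (df x)) -> locally_injective f a.
Proof.
move=> d0 dc fd.
have [r r0 rP] := near_interval (filterI fd (cvgr_neq0 (df a) dc d0)).
exists r => // s t sr tr fst.
have [k k01] := mean_value (fun x xr => (rP x xr).1) sr tr.
move=> /eqP; rewrite fst subrr eq_sym mulf_eq0 => /orP[|/eqP ?]; last by lra.
by rewrite (negbTE (rP _ _).2) //; nra.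
Qed.

(** If d3 a > 0, three applications of the mean value theorem give
    d1 x = c (x - a)^2 with c > 0: the derivative of f is positive on both sides of
    a, and f is strictly increasing through a. *)
Lemma cusp_locally_injective f (d1 d2 d3 : R -> R) a :
  d1 a = 0 -> d2 a = 0 -> d3 a != 0 -> {for a, continuous d3} ->
  (\forall x \near a, is_derive (x : R) (1 : R) f (d1 x)) ->
  (\forall x \near a, is_derive (x : R) (1 : R) d1 (d2 x)) ->
  (\forall x \near a, is_derive (x : R) (1 : R) d2 (d3 x)) -> locally_injective f a.
Proof.
wlog d3a : f d1 d2 d3 / 0 < d3 a => [wl z1 z2 d0 dc fd1 fd2 fd3|].
  have [dp|dn|dz] := ltgtP 0 (d3 a); last by rewrite -dz eqxx in d0.
    exact: (wl f d1 d2 d3).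
  have [||||||||r r0 inj] := wl (\- f) (\- d1) (\- d2) (\- d3).
  - by rewrite /= oppr_gt0.
  - by rewrite /= z1 oppr0.
  - by rewrite /= z2 oppr0.
  - by rewrite /= oppr_eq0.
  - exact: cvgN.
  - by apply: filterS fd1 => x fx; apply: is_deriveN.
  - by apply: filterS fd2 => x fx; apply: is_deriveN.
  - by apply: filterS fd3 => x fx; apply: is_deriveN.
  by exists r => // s t sr tr fst; apply: inj => //; by rewrite /= fst.
move=> z1 z2 _ dc fd1 fd2 fd3.
have d3p : \forall x \near a, 0 < d3 x by exact: (cvgr_gt (d3 a) dc 0 d3a).
have [r r0 rP] := near_interval (filterI (filterI fd1 fd2) (filterI fd3 d3p)).
have ar : a - r < a < a + r by lra.
have d1p x : a - r < x < a + r -> x != a -> 0 < d1 x.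
  move=> xr xa.
  have [k k01] := mean_value (fun y yr => (rP y yr).1.2) ar xr.
  rewrite z1 subr0 => ->.
  have yr : a - r < a + k * (x - a) < a + r by nra.
  have [l l01] := mean_value (fun y yr => (rP y yr).2.1) ar yr.
  rewrite z2 subr0 => ->.
  have zr : a - r < a + l * (a + k * (x - a) - a) < a + r by nra.
  have z0 := (rP _ zr).2.2; set z := d3 _ in z0 *.
  rewrite (_ : _ * _ = z * k * (x - a) ^+ 2); last by ring.
  have x2 : 0 < (x - a) ^+ 2 by rewrite exprn_even_gt0 // subr_eq0.
  have k0 : 0 < k by lra.
  by rewrite pmulr_lgt0 // mulr_gt0.
have incr s t : a - r < s < a + r -> a - r < t < a + r -> (t <= a) || (a <= s) ->
    s < t -> f s < f t.
  move=> sr tr side st; rewrite -subr_gt0.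
  have [k k01 ->] := mean_value (fun y yr => (rP y yr).1.1) sr tr.
  rewrite mulr_gt0 ?subr_gt0 // d1p //; first by nra.
  by apply/eqP => ya; case/orP: side; nra.
have strict s t : a - r < s < a + r -> a - r < t < a + r -> s < t -> f s < f t.
  move=> sr tr st; have [ta|at_] := leP t a; first by apply: incr; rewrite ?ta.
  have [sa|sa] := leP a s; first by apply: incr; rewrite ?sa ?orbT.
  by apply: (@lt_trans _ _ (f a)); apply: incr; rewrite ?lexx ?orbT.
exists r => // s t sr tr fst; apply/eqP; rewrite eq_le !leNgt.
by apply/andP; split; apply/negP => /strict; rewrite fst ltxx => /(_ _ _)/negP; apply.
Qed.

(** Near a the function f has slope at least |df a| / 2 in absolute value, near b
    the function g has slope at most |df a| / 4; so equal values force s to be at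
    least twice closer to a than t is to b. *)
Lemma slope_comparison (f df g dg : R -> R) a b :
  df a != 0 -> dg b = 0 -> {for a, continuous df} -> {for b, continuous dg} ->
  (\forall x \near a, is_derive (x : R) (1 : R) f (df x)) ->
  (\forall x \near b, is_derive (x : R) (1 : R) g (dg x)) -> f a = g b ->
  exists2 r, 0 < r & forall s t, a - r < s < a + r -> b - r < t < b + r ->
    f s = g t -> `|s - a| *+ 2 <= `|t - b|.
Proof.
move=> fa gb fc gc fD gD fagb; have m0 : 0 < `|df a| by rewrite normr_gt0.
have fN : \forall x \near a, `|df a| / 2 < `|df x|.
  by apply: (cvgr_norm_gt (df a) fc); lra.
have gN : \forall x \near b, `|dg x| < `|df a| / 4.
  by apply: (cvgr_norm_lt (dg b) gc); rewrite gb normr0; lra.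
have [r r0 rP] := near_interval (filterI fD fN).
have [e e0 eP] := near_interval (filterI gD gN).
exists (Num.min r e); first by rewrite lt_min r0.
have le_r : Num.min r e <= r by rewrite ge_min lexx.
have le_e : Num.min r e <= e by rewrite ge_min lexx orbT.
move=> s t sr tr fst.
have ar : a - r < a < a + r by lra.
have be : b - e < b < b + e by lra.
have {}sr : a - r < s < a + r by lra.
have {}tr : b - e < t < b + e by lra.
have [k k01 fE] := mean_value (fun y yr => (rP y yr).1) ar sr.
have [l l01 gE] := mean_value (fun y yr => (eP y yr).1) be tr.
have /rP[_ hf] : a - r < a + k * (s - a) < a + r by nra.
have /eP[_ hg] : b - e < b + l * (t - b) < b + e by nra.
have : `|f s - f a| = `|g t - g b| by rewrite fst fagb.
rewrite fE gE !normrM; move: hf hg.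
have := normr_ge0 (dg (b + l * (t - b))).
have := normr_ge0 (s - a); have := normr_ge0 (t - b).
set p := `|df (_ + _)|; set q := `|dg _|; set h := `|s - a|; set m := `|t - b|.
move=> m0' h0 q0 pf qf pq; rewrite -mulr_natl leNgt; apply/negP => mh.
have qm : q * m <= q * (2 * h) by rewrite ler_wpM2l // ltW.
have qh : q * (2 * h) <= `|df a| / 4 * (2 * h) by rewrite ler_wpM2r //; lra.
have hp : `|df a| / 2 * h < p * h by rewrite ltr_pM2r //; lra.
lra.
Qed.

End LocalInjectivity.

(** * Finiteness of the set of double points *)

Section DoublePoints.
Variables (R : realType) (F : surface R) (lam : legendrian F).
Notation plane := 'rV[R]_2.
Variable gen : generic_front lam.

Lemma is_derive_det2 (phi : R -> plane) (u : plane) (x : R) : derivable phi x 1 ->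
  is_derive x (1 : R) (fun s => det2 u (phi s)) (det2 u (derive1 phi x)).
Proof.
move=> dphi; have /derivable_mxP dc := dphi.
have dE i : derive1 phi x 0 i = 'D_1 (fun s => phi s 0 i) x.
  by rewrite derive1E derive_mx // mxE.
have d0 := derivableP (dc 0 0); have d1 := derivableP (dc 0 1).
have := is_deriveB (is_deriveZ (u 0 0) d1) (is_deriveZ (u 0 1) d0).
rewrite -!dE.
exact.
Qed.

Lemma base_periodic t (m : int) : base (lam (t + m%:~R)) = base (lam t).
Proof.
have per n s : lam (s + n%:R) = lam s.
  elim: n => [|n IHn]; first by rewrite addr0.
  by rewrite -addn1 natrD addrA legendrian_periodic.
case: m => n; first by rewrite -pmulrn per.
by rewrite NegzE mulrNz -[in RHS](subrK (n.+1)%:R t) per.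
Qed.

Lemma base_lam_continuous : continuous (fun t => base (lam t)).
Proof.
move=> t; apply: (@continuous_comp _ _ _ lam (@base R F)); first exact: cts_fun.
exact: base_continuous.
Qed.

Section Front.
Variable q : F.
Let phi := front_in q lam.
Let in_chart t := dom (chart_at q) (base (lam t)).

Lemma near_in_chart a : in_chart a -> \forall t \near a, in_chart t.
Proof.
move=> aq; apply: base_lam_continuous.
by apply: open_nbhs_nbhs; split=> //; exact: dom_open.
Qed.

Lemma front_is_derive n u a : in_chart a -> \forall x \near a,
  is_derive (x : R) (1 : R) (fun s => det2 u (derive1n n phi s)) (det2 u (derive1n n.+1 phi x)).
Proof.
move=> aq; apply: filterS (near_in_chart aq) => x xq.
have [dx _] := legendrian_smooth n xq.
by rewrite derive1nS; exact: is_derive_det2.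
Qed.

Lemma front_continuous n u a : in_chart a ->
  {for a, continuous (fun s => det2 u (derive1n n phi s))}.
Proof.
move=> aq; apply/differentiable_continuous/derivable1_diffP.
by have /nbhs_singleton da := front_is_derive n u aq; exact: ex_derive.
Qed.

End Front.

Lemma near_open_interval (a r : R) : 0 < r -> \forall s \near a, a - r < s < a + r.
Proof.
move=> r0; near=> s; rewrite -ltr_distl distrC; near: s; exact: (nbhsx_ballx a _ r0).
Unshelve. all: by end_near. Qed.

(** At a cusp the linear coordinate vanishing on the second derivative has zero
    first and second derivative and nonzero third derivative. At a regular point
    any linear coordinate that does not vanish on the velocity will do. *)
Lemma front_locally_injective a : period a ->
  \forall s \near a & t \near a, base (lam s) = base (lam t) -> s = t.
Proof.
move=> pa; pose q := base (lam a); pose phi := front_in q lam.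
have aq : dom (chart_at q) (base (lam a)) by exact: mem_chart_at.
suff [u [r r0 inj]] : exists u, locally_injective (fun s => det2 u (phi s)) a.
  exists ([set s | a - r < s < a + r], [set s | a - r < s < a + r]).
    by split; exact: near_open_interval.
  by move=> [s t] /= [sr tr] st; apply: inj => //; rewrite /phi /front_in st.
have [v0|v0] := eqVneq (velocity lam a) 0.
  have [_ cusp] := singular_is_cusp gen (conj pa v0).
  exists (derive1n 2 phi a).
  apply: (cusp_locally_injective _ _ _ _ (front_is_derive 0 _ aq)
    (front_is_derive 1 _ aq) (front_is_derive 2 _ aq)).
  - by rewrite [derive1n 1 phi a]v0 /det2 !mxE !mulr0 subrr.
  - by rewrite /det2 mulrC subrr.
  - exact: cusp.
  - exact: front_continuous.
set v := velocity lam a in v0.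
exists (\row_j if j == 0 then - v 0 1 else v 0 0).
apply: (regular_locally_injective _ _ (front_is_derive 0 _ aq)).
  rewrite (_ : derive1n 1 phi a = v) // /det2 !mxE /= mulNr -opprD oppr_eq0 -!expr2.
  apply: contra_neq v0 => h; apply: eucl_eq0; rewrite /eucl /dot -!expr2 addrC.
  by rewrite h sqrtr0.
exact: front_continuous.
Qed.

(** When the images coincide, the velocities v and w are independent. The linear
    coordinate vanishing on w has nonzero slope at a and zero slope at b, and the
    one vanishing on v the converse; comparing slopes for both leaves only (a, b). *)
Lemma front_isolated a b : period a -> period b -> a != b ->
  \forall s \near a & t \near b, base (lam s) = base (lam t) -> s = a /\ t = b.
Proof.
move=> pa pb ab; have [eab|nab] := pselect (base (lam a) = base (lam b)); last first.
  have := @surface_hausdorff R F; rewrite open_hausdorff => /(_ _ _ (introN eqP nab)).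
  move=> [[U V] /= [/set_mem Ua /set_mem Vb] [oU oV /eqP UV0]].
  exists ([set s | U (base (lam s))], [set t | V (base (lam t))]).
    by split; apply: base_lam_continuous; exact: open_nbhs_nbhs.
  move=> [s t] /= [Us Vt] st; exfalso; rewrite -st in Vt.
  by rewrite -[False]/(set0 (base (lam s))) -UV0.
pose q := base (lam a); pose phi := front_in q lam.
have aq : dom (chart_at q) (base (lam a)) by exact: mem_chart_at.
have bq : dom (chart_at q) (base (lam b)) by rewrite -eab.
have D0 := double_point_transversal gen pa pb (elimN eqP ab) eab.
pose v := velocity lam a; pose w := velocity lam b.
have va : derive1n 1 phi a = v by [].
have wb : derive1n 1 phi b = w by rewrite /w /velocity /front_derivative -eab.
have phiab : phi a = phi b by rewrite /phi /front_in -eab.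
have det_anti (x y : plane) : det2 x y = - det2 y x by rewrite /det2; ring.
have det_self (x : plane) : det2 x x = 0 by rewrite /det2 mulrC subrr.
have wa0 : det2 w (derive1n 1 phi a) != 0 by rewrite va det_anti oppr_eq0.
have vb0 : det2 v (derive1n 1 phi b) != 0 by rewrite wb.
have wb0 : det2 w (derive1n 1 phi b) = 0 by rewrite wb.
have va0 : det2 v (derive1n 1 phi a) = 0 by rewrite va.
have [r r0 rP] := slope_comparison
  (df := fun s => det2 w (derive1n 1 phi s)) (dg := fun s => det2 w (derive1n 1 phi s))
  wa0 wb0 (@front_continuous q 1 w a aq)
  (@front_continuous q 1 w b bq) (front_is_derive 0 w aq) (front_is_derive 0 w bq)
  (congr1 (det2 w) phiab).
have [e e0 eP] := slope_comparison
  (df := fun s => det2 v (derive1n 1 phi s)) (dg := fun s => det2 v (derive1n 1 phi s))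
  vb0 va0 (@front_continuous q 1 v b bq)
  (@front_continuous q 1 v a aq) (front_is_derive 0 v bq) (front_is_derive 0 v aq)
  (congr1 (det2 v) (esym phiab)).
pose m := Num.min r e; have m0 : 0 < m by rewrite lt_min r0.
have mr : m <= r by rewrite ge_min lexx.
have me : m <= e by rewrite ge_min lexx orbT.
exists ([set s | a - m < s < a + m], [set s | b - m < s < b + m]).
  by split; exact: near_open_interval.
move=> [s t] /= [sm tm] st.
have phist : front_in q lam s = front_in q lam t by rewrite /front_in st.
have h1 : `|s - a| *+ 2 <= `|t - b|.
  apply: (rP _ _ (widen_interval mr sm) (widen_interval mr tm)).
  by rewrite !derive1n0 phist.
have h2 : `|t - b| *+ 2 <= `|s - a|.
  apply: (eP _ _ (widen_interval me tm) (widen_interval me sm)).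
  by rewrite !derive1n0 phist.
have [/eqP sa /eqP tb] := mutually_doubled_eq0 h1 h2.
by split; apply/eqP; rewrite -subr_eq0.
Qed.

Lemma near_shift_pair (P : R -> R -> Prop) (a b c d : R) :
  (\forall s \near a - c & t \near b - d, P s t) ->
  \forall s \near a & t \near b, P (s - c) (t - d).
Proof.
move=> [[U V] /= [nU nV] UVP].
have shift (x y : R) : (fun s => s - y) @ x --> x - y.
  by apply: cvgB; [exact: cvg_id|exact: cvg_cst].
exists ([set s | U (s - c)], [set t | V (t - d)]).
  by split; [exact: shift nU|exact: shift nV].
by move=> [s t] /= [Us Vt]; exact: (UVP (_, _)).
Qed.

(** The previous two results hold on a period; translating both parameters by
    integers extends them to all pairs. *)
Lemma front_locally_isolated (a b : R) :
  \forall s \near a & t \near b, base (lam s) = base (lam t) ->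
    (exists m : int, s = t + m%:~R) \/ (s = a /\ t = b).
Proof.
pose m := Num.floor a; pose n := Num.floor b.
have per (x : R) : period (x - (Num.floor x)%:~R).
  have := floorD1_gt x; rewrite intrD => x1.
  by rewrite /period /= subr_ge0 floor_le_tmp ltrBlDl.
have down s k : base (lam (s - k%:~R)) = base (lam s).
  by rewrite -mulrNz base_periodic.
have [ab|ab] := eqVneq (a - m%:~R) (b - n%:~R).
  have H := front_locally_injective (per a).
  rewrite {2}ab in H; apply: filterS (near_shift_pair H) => -[s t] /=.
  rewrite !down => /[apply] st; left; exists (m - n).
  by rewrite mulrzBr; lra.
apply: filterS (near_shift_pair (front_isolated (per a) (per b) ab)) => -[s t] /=.
by rewrite !down => /[apply] -[sa tb]; right; split; lra.
Qed.

(** Compactness of the square, used with the cofinite filter on the points v of the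
    surface: near a pair (a, b), the only point that can be a double point is the
    image of a. So all but finitely many v are not double points. *)
Lemma finite_double_points : finite_set (double_points lam).
Proof.
pose cofinite : set_system F := [set A | finite_set (~` A)].
have cofinite_filter : Filter cofinite.
  split=> [|A B fA fB|A B AB fA]; rewrite /cofinite /=.
  - by rewrite setCT.
  - by rewrite setCI finite_setU.
  - by apply: sub_finite_set fA; exact: subsetC.
pose K : set (R * R) := `[0, 1]%classic `*` `[0, 1]%classic.
have /compact_near_coveringP cK : compact K.
  by apply: compact_setX; exact: segment_compact.
pose P (v : F) (st : R * R) := base (lam st.1) = v -> base (lam st.2) = v ->
  exists m : int, st.1 = st.2 + m%:~R.
have cofP : cofinite [set v | K `<=` P v].
  apply: (cK _ cofinite P cofinite_filter) => -[a b] _.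
  exists ([set st : R * R | base (lam st.1) = base (lam st.2) ->
     (exists m : int, st.1 = st.2 + m%:~R) \/ (st.1 = a /\ st.2 = b)],
     [set v | v <> base (lam a)]).
    split; first by apply: filterS (front_locally_isolated a b).
    apply: (@sub_finite_set _ _ [set base (lam a)]); last exact: finite_set1.
    by move=> v /= /contrapT.
  move=> [[s t] v] /= [st va] sv tv.
  by have [|//|[sa _]] := st; [rewrite sv tv|case: va; rewrite -sv sa].
apply: sub_finite_set cofP => v [a [b [pa pb ab av bv]]] /= /(_ (a, b)) [|||m abm] //.
  by split; rewrite /= in_itv /=; move: pa pb => /andP[? ?] /andP[? ?];
    apply/andP; split=> //; exact: ltW.
rewrite /= in abm; apply: ab; rewrite abm; suff -> : m = 0 by rewrite addr0.
have a_lt : `|m%:~R : R| < 1.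
  move: pa pb; rewrite /period /= abm => /andP[? ?] /andP[? ?].
  by rewrite ltr_norml; lra.
have : (`|m|%:~R : R) < 1%:~R by rewrite intr_norm.
by rewrite ltr_int; lia.
Qed.

End DoublePoints.

(** * Arcs of a fiber *)

Section Arcs.
Variables (R : realType) (F : surface R).
Notation plane := 'rV[R]_2.
Implicit Types xi eta : STF F.

Lemma turn0 xi : turn xi 0 = xi.
Proof. by apply: eq_STF => //=; exact: rotate0. Qed.

Lemma turnD xi s t : turn (turn xi s) t = turn xi (s + t).
Proof. by apply: eq_STF => //=; rewrite addrC rotateD. Qed.

Lemma boundary_turn xi t :
  boundary (edge (turn xi) 0 t) = vertex R (turn xi t) - vertex R xi.
Proof.
rewrite boundary_edge; congr (_ - vertex R _); exact: turn0.
Qed.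

Lemma turn2pi xi : turn xi (pi *+ 2) = xi.
Proof. by apply: eq_STF => //=; exact: rotate2pi. Qed.

Lemma sin_neq0 (t : R) : `|t| < pi -> t != 0 -> sin t != 0.
Proof.
move=> tpi t0; have [tp|tn|tz] := ltgtP 0 t; last by rewrite -tz eqxx in t0.
  by rewrite gt_eqF // sin_gt0_pi // tp -(gtr0_norm tp).
by rewrite -oppr_eq0 -sinN gt_eqF // sin_gt0_pi // oppr_gt0 tn -(ltr0_norm tn).
Qed.

(** With u half the difference of the angles, the rotation by 2u fixes a unit
    vector, so 1 = cos (2u) and sin u = 0, while |u| < pi. *)
Lemma turn_inj xi s t : `|s - t| < pi *+ 2 -> turn xi s = turn xi t -> s = t.
Proof.
move=> st_lt /(congr1 (fun eta => codir eta)) /= st.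
pose u := (s - t) / 2.
have rotu : rotate (u *+ 2) (codir xi) = codir xi.
  have -> : u *+ 2 = - t + s by rewrite -mulr_natr divfK // addrC.
  by rewrite rotateD st -rotateD addNr rotate0.
have cos1 : cos (u *+ 2) = 1.
  have := dot_eucl (codir xi); rewrite codir_unit expr1n => c1.
  transitivity (dot (codir xi) (rotate (u *+ 2) (codir xi))); last by rewrite rotu.
  by rewrite -[LHS]mulr1 -c1 /dot !mxE /=; ring.
have su0 : sin u = 0.
  apply/eqP; rewrite -sqrf_eq0; apply/eqP.
  by move: cos1; rewrite mulr2n cosD -!expr2 cos2sin2; lra.
have [u0|u0] := eqVneq u 0.
  by apply/eqP; rewrite -subr_eq0; apply/eqP; move: u0; rewrite /u; lra.
have upi : `|u| < pi.
  by rewrite /u normrM (gtr0_norm (_ : 0 < 2^-1)) // ltr_pdivrMr // mulr_natr.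
by have := sin_neq0 upi u0; rewrite su0 eqxx.
Qed.

Lemma positive_arcE xi t : 0 <= t < pi *+ 2 ->
  positive_arc xi (turn xi t) = edge (turn xi) 0 t.
Proof.
move=> t2; rewrite /positive_arc; congr edge.
have [s2 st] := @xgetPex _ 0 [set s | 0 <= s < pi *+ 2 /\ turn xi s = turn xi t]
  (ex_intro _ t (conj t2 erefl)).
by apply: (turn_inj (xi := xi)) => //; rewrite ltr_norml; lra.
Qed.

Lemma short_arcE xi t : - pi < t < pi ->
  short_arc xi (turn xi t) = edge (turn xi) 0 t.
Proof.
move=> t2; rewrite /short_arc; congr edge.
have [s2 st] := @xgetPex _ 0 [set s | - pi < s < pi /\ turn xi s = turn xi t]
  (ex_intro _ t (conj t2 erefl)).
by apply: (turn_inj (xi := xi)) => //; rewrite ltr_norml; lra.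
Qed.

(** Prolonging the arc of the fiber by a full turn adds one fiber, which starts at
    the end point of the arc. *)
Lemma hclass_extra_turn (c : chain R 1 (STF F) int) xi t :
  boundary (c + edge (turn xi) 0 t) = 0 ->
  hclass (c + edge (turn xi) 0 (t + pi *+ 2)) =
  hclass (c + edge (turn xi) 0 t) + fiber_class (turn xi t).
Proof.
move=> ct0.
have f0 : boundary (edge (turn (turn xi t)) 0 (pi *+ 2)) = 0.
  by apply: boundary_loop; exact: etrans (turn0 _) (esym (turn2pi _)).
rewrite /fiber_class -(hclassD ct0 f0); apply/hclassP.
- have be : boundary (edge (turn xi) 0 (t + pi *+ 2)) = boundary (edge (turn xi) 0 t).
    apply: eq_boundary_edge; exact: etrans (esym (turnD _ _ _)) (turn2pi _).
  by rewrite raddfD /= be -[LHS]raddfD.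
- by rewrite raddfD /= ct0 f0 addr0.
have -> : edge (turn (turn xi t)) 0 (pi *+ 2) = edge (turn xi) t (t + pi *+ 2).
  rewrite (@edge_shift _ _ _ (turn xi) _ _ t) ?add0r 1?addrC // => s.
  by apply: (etrans (turnD _ _ _)); rewrite addrC.
have [e ee] := edge_cat (turn xi) 0 t (t + pi *+ 2); exists (- e).
by rewrite raddfN /= ee opprB -(addrA c (edge (turn xi) 0 t)) [in RHS]opprD addrACA subrr add0r.
Qed.

(** For t >= 0 the shortest arc is already positive; for t < 0 the positive arc is
    the one of angle t + 2 pi. *)
Lemma positive_short_arc (c : chain R 1 (STF F) int) xi t :
  - pi < t < pi -> boundary (c + edge (turn xi) 0 t) = 0 ->
  hclass (c + positive_arc xi (turn xi t)) = hclass (c + short_arc xi (turn xi t)) +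
    (if t < 0 then fiber_class (turn xi t) else 0).
Proof.
move=> tpi c0; rewrite short_arcE //; case: ltP => t0.
  have tE : turn xi t = turn xi (t + pi *+ 2) by rewrite -turnD turn2pi.
  rewrite {1}tE positive_arcE; last by have := pi_gt0 R; lra.
  exact: hclass_extra_turn.
by rewrite addr0 positive_arcE //; have := pi_gt0 R; lra.
Qed.

End Arcs.

(** * The two branches at a double point *)

Section Branches.
Variables (R : realType) (F : surface R) (lam : legendrian F).
Notation plane := 'rV[R]_2.

(** In a frame of the plane where the incoming vector is (1, 1) and the outgoing one
    is (-1, 1), both up to the same factor, the determinant is that of the frame
    change up to a positive factor; conversely, if the determinant is positive the
    frame change written below has these properties. *)
Lemma turns_leftP (w_in w_out : plane) : turns_left w_in w_out <-> 0 < det2 w_in w_out.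
Proof.
split=> [[P [P0 iy oy ix ox]]|d0].
  have : 0 < \det P * det2 w_in w_out.
    have -> : \det P * det2 w_in w_out = det2 (w_in *m P) (w_out *m P).
      by rewrite det_mx2 /det2 !mulmx2E; ring.
    rewrite /det2; move: iy oy ix ox.
    set x := (w_in *m P) 0 0; set y := (w_in *m P) 0 1.
    set z := (w_out *m P) 0 0; set w := (w_out *m P) 0 1; nra.
  by rewrite pmulr_rgt0.
pose P : 'M[R]_2 := \matrix_(i, j)
  if i == 0 then if j == 0 then w_out 0 1 + w_in 0 1 else w_out 0 1 - w_in 0 1
  else if j == 0 then - w_out 0 0 - w_in 0 0 else w_in 0 0 - w_out 0 0.
exists P; rewrite det_mx2 !mulmx2E !mxE /=; move: d0; rewrite /det2 => d0.
by split; lra.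
Qed.

(** The Legendrian condition, read in the chart singled out at the point itself,
    where the components of a contact element are its own. *)
Lemma codir_velocity t : dot (codir (lam t)) (velocity lam t) = 0.
Proof.
have := legendrian_tangent (mem_chart_at (base (lam t))).
by rewrite /coor_in comps_base.
Qed.

(** The velocity is orthogonal to the unit covector, so it is that covector turned
    by a right angle and multiplied by the determinant of the two. *)
Lemma det2_velocity a b : det2 (velocity lam b) (velocity lam a) =
  det2 (codir (lam b)) (velocity lam b) * det2 (codir (lam a)) (velocity lam a) *
  det2 (codir (lam b)) (codir (lam a)).
Proof.
have vE t : velocity lam t 0 0 =
      - det2 (codir (lam t)) (velocity lam t) * codir (lam t) 0 1 /\
    velocity lam t 0 1 = det2 (codir (lam t)) (velocity lam t) * codir (lam t) 0 0.
  have := dot_eucl (codir (lam t)); have := codir_velocity t.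
  rewrite codir_unit expr1n /dot /det2.
  set x := velocity lam t 0 0; set y := velocity lam t 0 1.
  set c := codir (lam t) 0 0; set s := codir (lam t) 0 1 => cv c1.
  have xE : x = (c * c + s * s) * x by rewrite c1 mul1r.
  have yE : y = (c * c + s * s) * y by rewrite c1 mul1r.
  split; [rewrite {1}xE|rewrite {1}yE].
    apply/eqP; rewrite -subr_eq0; apply/eqP.
    by transitivity (c * (c * x + s * y)); [ring|rewrite cv mulr0].
  apply/eqP; rewrite -subr_eq0; apply/eqP.
  by transitivity (s * (c * x + s * y)); [ring|rewrite cv mulr0].
have [a0 a1] := vE a; have [b0 b1] := vE b.
by rewrite {1}/det2 a0 a1 b0 b1 [X in _ = _ * X]/det2; ring.
Qed.

Variable gen : generic_front lam.

(** The two parameters at a double point are ordered by the sign of the determinant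
    of the velocities, which transversality makes nonzero. *)
Lemma branchesP v : double_points lam v ->
  [/\ period (branches lam v).1, period (branches lam v).2,
      base (lam (branches lam v).1) = v, base (lam (branches lam v).2) = v &
      0 < det2 (velocity lam (branches lam v).2) (velocity lam (branches lam v).1)].
Proof.
move=> [a [b [pa pb ab av bv]]].
have D := double_point_transversal gen pa pb ab (etrans av (esym bv)).
have det_anti (x y : plane) : det2 x y = - det2 y x by rewrite /det2; ring.
suff ex : exists ab : R * R, [/\ period ab.1, period ab.2, base (lam ab.1) = v,
    base (lam ab.2) = v & turns_left (velocity lam ab.2) (velocity lam ab.1)].
  by have [? ? ? ? /turns_leftP ?] := xgetPex (0, 0) ex.
have [d|d|d] := ltgtP 0 (det2 (velocity lam a) (velocity lam b)).
- by exists (b, a); split=> //; exact/turns_leftP.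
- by exists (a, b); split=> //; apply/turns_leftP; rewrite det_anti oppr_gt0.
- by rewrite -d eqxx in D.
Qed.

Lemma boundary_arc a b : boundary (Defs.arc lam a b) = vertex R (lam b) - vertex R (lam a).
Proof.
rewrite /Defs.arc; case: ifP => _; rewrite boundary_edge //.
congr (vertex R _ - _); exact: legendrian_periodic.
Qed.

(** With lam a = turn (lam b) t, the shortest arcs have angle t from lam b, on the
    left loop, and angle - t from lam a, on the right loop; exactly one of t and
    - t is negative, and that loop gains a full turn. *)
Lemma lambda_tilde_diff v (f : H1 R (STF F) int) :
  (forall xi, fiber_class xi = f) -> double_points lam v ->
  lambda_tilde_plus lam v - lambda_tilde_minus lam v =
  lambda_plus lam v - lambda_minus lam v - f *~ epsilon lam v.
Proof.
move=> fE /branchesP.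
rewrite /lambda_tilde_plus /lambda_tilde_minus /lambda_plus /lambda_minus /epsilon.
case: (branches lam v) => a b /= [pa pb av bv D].
have [t [tpi ab st]] := rotate_between (codir_unit (lam b)) (codir_unit (lam a)).
have xaE : lam a = turn (lam b) t by apply: eq_STF => //=; rewrite av bv.
have xbE : lam b = turn (lam a) (- t) by rewrite xaE turnD subrr turn0.
have s0 : sin t != 0.
  by rewrite st; apply: contraTneq D => d; rewrite det2_velocity d mulr0 ltxx.
have {}tpi : - pi < t < pi.
  case/andP: tpi => t1; rewrite le_eqVlt => /predU1P[te|->]; last by rewrite t1.
  by rewrite te sinpi eqxx in s0.
have cab : boundary (Defs.arc lam a b + edge (turn (lam b)) 0 t) = 0.
  by rewrite raddfD /= boundary_arc boundary_turn -xaE addrA subrK subrr.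
have cba : boundary (Defs.arc lam b a + edge (turn (lam a)) 0 (- t)) = 0.
  by rewrite raddfD /= boundary_arc boundary_turn -xbE addrA subrK subrr.
have tpi' : - pi < - t < pi by lra.
have := positive_short_arc tpi cab; rewrite -xaE fE => ->.
have := positive_short_arc tpi' cba; rewrite -xbE fE => ->.
rewrite /positive_branch oppr_lt0; move: D; rewrite det2_velocity -st.
move: (hclass _) (hclass _) => P M.
set sb := det2 (codir (lam b)) _; set sa := det2 (codir (lam a)) _; clearbody sb sa.
have [t0|t0|t0] := ltgtP 0 t; last by rewrite -t0 sin0 eqxx in s0.
- have sint : 0 < sin t by rewrite sin_gt0_pi // t0; case/andP: tpi.
  rewrite pmulr_lgt0 // => sab; have -> : (0 < sa) = (0 < sb).
    by apply/idP/idP => s_gt0; [rewrite pmulr_lgt0 in sab|rewrite pmulr_rgt0 in sab].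
  by rewrite eqxx addr0 mulr1z opprD addrA.
- have sint : 0 < - sin t by rewrite -sinN sin_gt0_pi // oppr_gt0 t0; case/andP: tpi'.
  rewrite -mulrNN pmulr_lgt0 // oppr_gt0 => sab; have -> : (0 < sa) = ~~ (0 < sb).
    rewrite -leNgt; apply/idP/idP => [sa0|sb0].
      by rewrite pmulr_llt0 // in sab; exact: ltW.
    have sb_lt : sb < 0.
      by rewrite lt_neqAle sb0 andbT; apply: contraTneq sab => ->; rewrite mul0r ltxx.
    by rewrite nmulr_rlt0 in sab.
  by case: (0 < sb); rewrite addr0 mulrN1z opprK addrAC.
Qed.

End Branches.

Theorem theorem5p3p7 (R : realType) (F : surface R) (lam : legendrian F)
    (xi : STF F) (gen : generic_front lam) :
  pr (S_invariant lam (fiber_class xi)) = l_invariant lam (fiber_class xi).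
Proof.
have fE eta : fiber_class eta = fiber_class xi by exact: (fiber_class_const eta xi).
have fin := finite_double_points gen.
have sumE : \sum_(v \in double_points lam)
      hpow (lambda_tilde_plus lam v - lambda_tilde_minus lam v) half_unit =
    \sum_(v \in double_points lam)
      hpow (lambda_plus lam v - lambda_minus lam v - fiber_class xi *~ epsilon lam v) half_unit.
  apply: eq_fsbigr => v /set_mem vD.
  congr hpow; exact: (lambda_tilde_diff gen fE vD).
rewrite /l_invariant -sumE.
exact: (pr_sum_formalB3 _ _ _ _ _ _ _ _ fin).
Qed.
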